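(* Two cut-free MALL$^{-}$ proofs translate to the same proof net if and only if they can be converted into each other by a series of rule commutations.
   Context: MALL$^{-}$ is cut-free multiplicative-additive linear logic without units. Formulas are built from literals (propositional variables $P,Q,\ldots$ and their negations $P^\perp,\ldots$) by the binary connectives tensor $\otimes$, par ($⅋$), with $\&$ and plus $\oplus$; negation extends to all formulas by de Morgan duality. A sequent is a disjoint union of formulas, viewed as a forest of labelled parse trees. Sequents are proved with the rules: axiom ($P,P^\perp$); $\otimes$ (from $\Gamma,A$ and $B,\Delta$ infer $\Gamma,A\otimes B,\Delta$); par (from $\Gamma,A,B$ infer $\Gamma,A⅋B$); $\&$ (from $\Gamma,A$ and $\Gamma,B$ infer $\Gamma,A\&B$); $\oplus_1$, $\oplus_2$ (from $\Gamma,A$, resp. $\Gamma,B$, infer $\Gamma,A\oplus B$); and optionally mix (from $\Gamma$ and $\Delta$ infer $\Gamma,\Delta$). The result holds both with and without mix. A link on $\Gamma$ is a pair of leaves of $\Gamma$, a linking is a set of links. For a proof $\Pi$ of $\Gamma$, a $\&$-resolution $R$ is any result of deleting one branch above each $\&$-rule of $\Pi$; by tracking formula leaves downwards, the axiom rules of $R$ determine a linking $\lambda_R$ on $\Gamma$, and the translation of $\Pi$ is the linking set $\theta_\Pi=\{\lambda_R : R$ a $\&$-resolution of $\Pi\}$. A linking set is a proof net if it is the translation of some proof. A rule commutation is a transposition of two adjacent rules that preserves the subproofs immediately above, possibly duplicating or identifying them (formally: replacing, in context, a proof fragment consisting of a $\beta$-rule directly below $\alpha$-rules by a fragment with the order reversed,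 both fragments deriving the same pure rule); these are exhaustively enumerated in the paper (e.g. par over par, $\oplus$ over $\oplus$, $\otimes$ over $\otimes$, $\&$ over $\&$, $\otimes$ over $\&$ with duplication of the other $\otimes$-premise's subproof, etc.). *)

(* Defs.v *)
From mathcomp Require Import all_boot finmap.
From Stdlib Require Import Relations.

Set Implicit Arguments.
Unset Strict Implicit.
Unset Printing Implicit Defensive.

Local Open Scope fset_scope.

(* Formulas over propositional variables in V.  [NVar P] is P^perp; negation
   is only needed on variables because axioms are on literals and there is no
   cut. *)
Inductive form (V : Type) : Type :=
| Var of V
| NVar of V
| Tens of form V & form V
| Parr of form V & form V
| Amp of form V & form V
| Oplus of form V & form V.

(* A list of formulas G is the forest of its parse trees.  A vertex of the
   forest is named by the index of its tree and the path from the root of that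
   tree ([false] = left, [true] = right).  Formula occurrences and leaves are
   vertices. *)
Definition vertex := (nat * seq bool)%type.

Definition lchild (x : vertex) : vertex := (x.1, rcons x.2 false).
Definition rchild (x : vertex) : vertex := (x.1, rcons x.2 true).

Fixpoint subform_path (V : Type) (A : form V) (w : seq bool) : option (form V) :=
  if w is b :: w' then
    match A with
    | Var _ | NVar _ => None
    | Tens B C | Parr B C | Amp B C | Oplus B C =>
        subform_path (if b then C else B) w'
    end
  else Some A.

Definition subform (V : Type) (G : seq (form V)) (x : vertex) :
    option (form V) :=
  obind (fun A => subform_path A x.2) (onth G x.1).

(* Every formula occurring in a cut-free proof of G is a subformula occurrence
   of G, so the sequents of such a proof are sets of vertices of G.  Tracking
   leaves downwards through the proof is then the identity on vertices. *)
Definition sequent := {fset vertex}.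

Definition root_sequent (V : Type) (G : seq (form V)) : sequent :=
  [fset x in [seq (i, [::]) | i <- iota 0 (size G)]].

(* [RPlus false x] is the first plus rule (premise contains the left child of
   x), [RPlus true x] the second. *)
Inductive unary_rule := RPar of vertex | RPlus of bool & vertex.
Inductive split_rule := RTensor of vertex | RMix.

Inductive proof : Type :=
| PAx of vertex & vertex
| PUn of unary_rule & proof
| PSplit of split_rule & proof & proof
| PWith of vertex & proof & proof.

(* [derives mix G S p]: p is a proof of the sequent S of vertices of G; the mix
   rule is available iff [mix] holds.  The side conditions with \notin and
   [disjoint] say that the comma of sequents is a disjoint union.  An axiom
   lists its positive leaf first, so that it has only one representation. *)
Inductive derives (V : Type) (mix : bool) (G : seq (form V)) :
    sequent -> proof -> Prop :=
| DAx (x y : vertex) P of subform G x = Some (Var P) & subform G y = Some (NVar P) :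
    derives mix G [fset x; y] (PAx x y)
| DTensor (x : vertex) A B (S T : sequent) p q of
    subform G x = Some (Tens A B) &
    [disjoint S & T] & x \notin S `|` T & lchild x \notin S & rchild x \notin T &
    derives mix G (lchild x |` S) p & derives mix G (rchild x |` T) q :
    derives mix G (x |` (S `|` T)) (PSplit (RTensor x) p q)
| DPar (x : vertex) A B (S : sequent) p of
    subform G x = Some (Parr A B) &
    x \notin S & lchild x \notin S & rchild x \notin S &
    derives mix G (lchild x |` (rchild x |` S)) p :
    derives mix G (x |` S) (PUn (RPar x) p)
| DWith (x : vertex) A B (S : sequent) p q of
    subform G x = Some (Amp A B) &
    x \notin S & lchild x \notin S & rchild x \notin S &
    derives mix G (lchild x |` S) p & derives mix G (rchild x |` S) q :
    derives mix G (x |` S) (PWith x p q)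
| DPlus1 (x : vertex) A B (S : sequent) p of
    subform G x = Some (Oplus A B) & x \notin S & lchild x \notin S &
    derives mix G (lchild x |` S) p :
    derives mix G (x |` S) (PUn (RPlus false x) p)
| DPlus2 (x : vertex) A B (S : sequent) p of
    subform G x = Some (Oplus A B) & x \notin S & rchild x \notin S &
    derives mix G (rchild x |` S) p :
    derives mix G (x |` S) (PUn (RPlus true x) p)
| DMix (S T : sequent) p q of
    mix & [disjoint S & T] & derives mix G S p & derives mix G T q :
    derives mix G (S `|` T) (PSplit RMix p q).

Definition is_proof (V : Type) (mix : bool) (G : seq (form V)) (p : proof) :=
  derives mix G (root_sequent G) p.

(* A &-resolution is a proof tree in which every &-rule has kept exactly one of
   its branches: the left one for [false], the right one for [true]. *)
Inductive resolution : Type :=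
| ResAx of vertex & vertex
| ResUn of unary_rule & resolution
| ResSplit of split_rule & resolution & resolution
| ResWith of vertex & bool & resolution.

Fixpoint resolutions (p : proof) : seq resolution :=
  match p with
  | PAx x y => [:: ResAx x y]
  | PUn u p => [seq ResUn u R | R <- resolutions p]
  | PSplit s p q =>
      [seq ResSplit s R R' | R <- resolutions p, R' <- resolutions q]
  | PWith x p q =>
      [seq ResWith x false R | R <- resolutions p] ++
      [seq ResWith x true R | R <- resolutions q]
  end.

Definition link := {fset vertex}.
Definition linking := {fset link}.

Fixpoint linking_of (R : resolution) : linking :=
  match R with
  | ResAx x y => [fset [fset x; y]]
  | ResUn _ R => linking_of R
  | ResSplit _ R R' => linking_of R `|` linking_of R'
  | ResWith _ _ R => linking_of R
  end.

Definition translation (p : proof) : {fset linking} :=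
  [fset l in [seq linking_of R | R <- resolutions p]].

(* The shapes of the transpositions of two adjacent rules, each listed in one of
   its two directions.  A shape is a rule commutation only when both sides derive
   the same sequent (see [commutation]): for instance a par-rule below a
   tensor-rule moves up only if both of its arguments lie in the same premise of
   the tensor. *)
Inductive transpose : proof -> proof -> Prop :=
| TUnUn u v p : transpose (PUn u (PUn v p)) (PUn v (PUn u p))
| TSplitUnL s u p q :
    transpose (PSplit s (PUn u p) q) (PUn u (PSplit s p q))
| TSplitUnR s u p q :
    transpose (PSplit s p (PUn u q)) (PUn u (PSplit s p q))
| TWithUn x u p q :
    transpose (PWith x (PUn u p) (PUn u q)) (PUn u (PWith x p q))
| TSplitSplitRL s t p q r :
    transpose (PSplit s p (PSplit t q r)) (PSplit t (PSplit s p q) r)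
| TSplitSplitRR s t p q r :
    transpose (PSplit s p (PSplit t q r)) (PSplit t q (PSplit s p r))
| TSplitSplitLL s t p q r :
    transpose (PSplit s (PSplit t p q) r) (PSplit t (PSplit s p r) q)
| TSplitWithL s x p q r :
    transpose (PSplit s (PWith x p q) r)
              (PWith x (PSplit s p r) (PSplit s q r))
| TSplitWithR s x p q r :
    transpose (PSplit s p (PWith x q r))
              (PWith x (PSplit s p q) (PSplit s p r))
| TWithWith x y p q r s :
    transpose (PWith x (PWith y p q) (PWith y r s))
              (PWith y (PWith x p r) (PWith x q s)).

(* One rule commutation, in context.  Sequents being unordered, so are the two
   premises of mix: [CMixC] is not a commutation, it identifies the two
   representations of a mix rule as a binary node.  (The premises of tensor and
   & are told apart by the child of the principal formula they contain.) *)
Inductive commutation (V : Type) (mix : bool) (G : seq (form V)) :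
    proof -> proof -> Prop :=
| CHere S p q of transpose p q & derives mix G S p & derives mix G S q :
    commutation mix G p q
| CMixC p q : commutation mix G (PSplit RMix p q) (PSplit RMix q p)
| CUn u p p' of commutation mix G p p' : commutation mix G (PUn u p) (PUn u p')
| CSplitL s p p' q of commutation mix G p p' :
    commutation mix G (PSplit s p q) (PSplit s p' q)
| CSplitR s p q q' of commutation mix G q q' :
    commutation mix G (PSplit s p q) (PSplit s p q')
| CWithL x p p' q of commutation mix G p p' :
    commutation mix G (PWith x p q) (PWith x p' q)
| CWithR x p q q' of commutation mix G q q' :
    commutation mix G (PWith x p q) (PWith x p q').

Definition convertible (V : Type) (mix : bool) (G : seq (form V)) :
    proof -> proof -> Prop :=
  clos_refl_sym_trans proof (commutation mix G).

(* Main.v *)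
Require Import Defs.
From mathcomp Require Import all_boot finmap.
From Stdlib Require Import Relations.

(* Commutations visibly preserve the translation.  Conversely, let p and q prove
   the same sequent with the same linkings, and induct on the size of that
   sequent: it is enough to convert p to a proof ending with the last rule of q
   whose premises have the same linkings as those of q.  A par or a & can always
   be moved to the bottom, a plus as soon as all linkings choose the same
   argument.  If q ends with a tensor or mix, colour the vertices by the premise
   of q they belong to.  The linkings of q, hence those of p, then have only
   monochrome links and are closed under recombining the two colours of two
   linkings.  Both properties pass to the subproofs of p, so by induction on p
   the two colours can be separated, down to the root.  The only difficulty is a
   & rule of one colour, where both premises have been separated and the
   parts of the other colour have to be identified: they prove the same smaller
   sequent and, by recombination, have the same linkings, so they are
   interconvertible by the induction on the size. *)

Set Implicit Arguments.
Unset Strict Implicit.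
Unset Printing Implicit Defensive.

Local Open Scope fset_scope.

(** * Vertices and derivations *)

(** The rules of [derives] merely forbid repeated vertices, which says nothing about the children
    that another rule introduces once two rules are transposed. The missing side conditions come
    from an invariant: the root sequent is an antichain for the ancestor order, hence so is every
    sequent of its proofs, and disjoint parts of an antichain are even incomparable ([apart]).
    Incomparability passes from a formula to its children, so in a transposition it is enough that
    principal formulas and contexts are pairwise incomparable. Mix shapes the separation. Hence one
    side of a separation is an optional proof, whose presence is itself evidence that mix is
    allowed. At a tensor the principal formula lies across both colours, so a second induction is
    needed; material of the wrong colour beside the tensor is first split off as an optional proof
    and then moved to the other side. *)

Definition child (b : bool) (x : vertex) : vertex := (x.1, rcons x.2 b).

Definition below (u v : vertex) := (u.1 == v.1) && prefix u.2 v.2.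

Definition cmp (u v : vertex) := below u v || below v u.

Definition apart (S T : sequent) :=
  forall u v, u \in S -> v \in T -> ~~ cmp u v.

Definition antichain (S : sequent) :=
  forall u v, u \in S -> v \in S -> below u v -> u = v.

Definition children (x : vertex) (A : sequent) :=
  forall v, v \in A -> exists b, v = child b x.

Lemma below_refl x : below x x.
Proof. by rewrite /below eqxx prefix_refl. Qed.

Lemma below_trans x y z : below x y -> below y z -> below x z.
Proof.
move=> /andP[/eqP h1 h2] /andP[/eqP k1 k2].
by rewrite /below h1 k1 eqxx (prefix_trans h2).
Qed.

Lemma cmpC x y : cmp x y = cmp y x.
Proof. exact: orbC. Qed.

Lemma cmp_refl x : cmp x x.
Proof. by rewrite /cmp below_refl. Qed.

Lemma below_child b x : below x (child b x).
Proof. by rewrite /below /= eqxx prefix_rcons. Qed.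

Lemma below_childE b x y : below y (child b x) = below y x || (y == child b x).
Proof.
case: x y => i s [j r]; rewrite /below /child /= xpair_eqE -andb_orr.
case: eqP => //= _; apply/prefixP/orP => [[t]|].
  elim/last_ind: t => [|t c _]; first by rewrite cats0 => ->; right.
  rewrite -rcons_cat => /rcons_inj[-> _]; left; exact: prefix_prefix.
case=> [/prefixP[t ->]|/eqP->]; last by exists [::]; rewrite cats0.
by exists (rcons t b); rewrite rcons_cat.
Qed.

Lemma child_not_below b x : below (child b x) x = false.
Proof.
apply/negP=> /andP[_ /size_prefix]; by rewrite /= size_rcons ltnn.
Qed.

Lemma child_inj b c x y : child b x = child c y -> b = c /\ x = y.
Proof. by case: x y => i s [j r] [-> /rcons_inj[-> ->]]. Qed.

Lemma cmp_child b x y : cmp (child b x) y -> cmp x y.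
Proof.
case/orP=> [h|]; first by rewrite /cmp (below_trans (below_child b x) h).
by rewrite below_childE => /orP[h|/eqP->]; rewrite /cmp ?h ?below_child ?orbT.
Qed.

Lemma cmp_children b c x : cmp (child b x) (child c x) -> b = c.
Proof.
by rewrite /cmp !below_childE !child_not_below /=
  => /orP[] /eqP /child_inj[].
Qed.

(** The ancestors of a vertex form a chain. Hence a leaf lying under two sequents contradicts their
    being [apart]. *)
Lemma below_cmp u v w : below u w -> below v w -> cmp u v.
Proof.
case/andP=> [/eqP u1 /prefixP[a u2]] /andP[/eqP v1 /prefixP[b v2]].
rewrite /cmp /below u1 v1 eqxx /= !prefixE.
case: (leqP (size u.2) (size v.2)) => [h|/ltnW h].
  by rewrite -(takel_cat b h) -v2 u2 take_size_cat // eqxx.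
by rewrite -(takel_cat a h) -u2 v2 take_size_cat // eqxx orbT.
Qed.

Lemma apartC S T : apart S T -> apart T S.
Proof. by move=> h u v uT vS; rewrite cmpC h. Qed.

Lemma apart_sub S S' T T' :
  apart S T -> S' `<=` S -> T' `<=` T -> apart S' T'.
Proof.
by move=> h /fsubsetP sS /fsubsetP sT u v /sS uS /sT vT; apply: h.
Qed.

Lemma apartUl S T U : apart (S `|` T) U <-> apart S U /\ apart T U.
Proof.
split=> [h|[hS hT] u v]; last first.
  by rewrite inE => /orP[uS|uT] vU; [apply: hS|apply: hT].
by split; apply: apart_sub h _ (fsubset_refl _); rewrite ?fsubsetUl ?fsubsetUr.
Qed.

Lemma apartUr S T U : apart U (S `|` T) <-> apart U S /\ apart U T.
Proof.
split=> [/apartC/apartUl[] /apartC ? /apartC //|[hS hT]].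
by apply/apartC/apartUl; split; apply/apartC.
Qed.

Lemma apart0l S : apart fset0 S.
Proof. by move=> u v; rewrite inE. Qed.

Lemma apart0r S : apart S fset0.
Proof. by move=> u v _; rewrite inE. Qed.

Lemma apart_disjoint S T : apart S T -> [disjoint S & T].
Proof.
move=> h; apply/fdisjointP => x xS; apply/negP => xT.
by have := h _ _ xS xT; rewrite cmp_refl.
Qed.

Lemma apart_children x A S : children x A -> apart [fset x] S -> apart A S.
Proof.
move=> hA hS u v /hA[b ->] vS; apply: contra (hS x v _ vS); last by rewrite inE.
exact: cmp_child.
Qed.

Lemma children_below x A v : children x A -> v \in A -> below x v.
Proof. by move=> h /h[b ->]; apply: below_child. Qed.

Lemma antichain_sub S T : antichain T -> S `<=` T -> antichain S.
Proof. by move=> h /fsubsetP sT u v /sT uT /sT vT; apply: h. Qed.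

Lemma antichain_apart S T :
  antichain (S `|` T) -> [disjoint S & T] -> apart S T.
Proof.
move=> h /fdisjointP d u v uS vT; apply/negP.
have uST : u \in S `|` T by rewrite inE uS.
have vST : v \in S `|` T by rewrite inE vT orbT.
case/orP=> [/(h _ _ uST vST) e|/(h _ _ vST uST) e]; move: (d u uS).
  by rewrite e vT.
by rewrite -e vT.
Qed.

Lemma antichainU S T :
  antichain S -> antichain T -> apart S T -> antichain (S `|` T).
Proof.
move=> hS hT hST u v; rewrite !inE.
case/orP=> hu /orP[] hv huv; first exact: hS; last exact: hT.
- by have := hST _ _ hu hv; rewrite /cmp huv.
- by have := hST _ _ hv hu; rewrite /cmp huv orbT.
Qed.

Lemma antichain_children x A : children x A -> antichain A.
Proof.
move=> hA u v /hA[b ->] /hA[c ->] h; have := @cmp_children b c x.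
by rewrite /cmp h => ->.
Qed.

Lemma antichain_premise x A S :
  children x A -> apart [fset x] S -> antichain ([fset x] `|` S) ->
  antichain (A `|` S).
Proof.
move=> hA hS h; apply: antichainU (apart_children hA hS).
  exact: antichain_children hA.
by apply: antichain_sub h _; rewrite fsubsetUr.
Qed.

Definition un_principal (u : unary_rule) : vertex :=
  match u with RPar x | RPlus _ x => x end.

Definition un_active (u : unary_rule) : sequent :=
  match u with
  | RPar x => [fset child false x; child true x]
  | RPlus b x => [fset child b x]
  end.

(** Mix is treated as a tensor without principal formula and without active children, so that both
    rules share their lemmas. *)
Definition split_principal (s : split_rule) : sequent :=
  if s is RTensor x then [fset x] else fset0.

Definition split_active (b : bool) (s : split_rule) : sequent :=
  if s is RTensor x then [fset child b x] else fset0.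

Lemma children1 b x : children x [fset child b x].
Proof. by move=> v; rewrite inE => /eqP->; exists b. Qed.

Lemma children_un u : children (un_principal u) (un_active u).
Proof.
case: u => [x|b x] /=; last exact: children1.
by move=> v; rewrite !inE => /orP[]/eqP->; [exists false|exists true].
Qed.

Lemma apart_un u S : apart [fset un_principal u] S -> apart (un_active u) S.
Proof. exact: apart_children (@children_un u). Qed.

Lemma apart_split b s S : apart (split_principal s) S -> apart (split_active b s) S.
Proof.
by case: s => [x|] //= h; apply: apart_children h; apply: children1.
Qed.

Lemma apart_split_active s : apart (split_active false s) (split_active true s).
Proof.
case: s => [x|] /=; last exact: apart0l.
move=> u v; rewrite !inE => /eqP-> /eqP->.
by apply/negP => /cmp_children.
Qed.

Lemma apart1_children x S :
  x \notin S -> antichain ([fset x] `|` S) -> apart [fset x] S.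
Proof. by move=> xS h; apply: antichain_apart => //; rewrite fdisjoint1X. Qed.

Section Derivations.

Variables (V : Type) (mix : bool) (G : seq (form V)).

Notation derives := (derives mix G).

Definition un_ok (u : unary_rule) : Prop :=
  match u with
  | RPar x => exists A B, subform G x = Some (Parr A B)
  | RPlus _ x => exists A B, subform G x = Some (Oplus A B)
  end.

Definition split_ok (s : split_rule) : Prop :=
  if s is RTensor x then exists A B, subform G x = Some (Tens A B) else mix.

Definition with_ok (x : vertex) : Prop :=
  exists A B, subform G x = Some (Amp A B).

Lemma apart_notin x y S : cmp x y -> apart [fset x] S -> y \notin S.
Proof.
move=> c h; apply/negP => yS.
by have := h x y; rewrite c inE eqxx yS => /(_ isT isT).
Qed.

Lemma derives_un u S p :
  un_ok u -> apart [fset un_principal u] S -> derives (un_active u `|` S) p ->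
  derives ([fset un_principal u] `|` S) (PUn u p).
Proof.
have c b x : cmp x (child b x) by rewrite /cmp below_child.
case: u => [x|[] x] /= [A [B e]] h d.
- apply: DPar e _ _ _ _; rewrite ?(apart_notin _ h) ?cmp_refl ?c //.
  by rewrite fsetUA.
- by apply: DPlus2 e _ _ d; rewrite ?(apart_notin _ h) ?cmp_refl ?c.
- by apply: DPlus1 e _ _ d; rewrite ?(apart_notin _ h) ?cmp_refl ?c.
Qed.

Lemma derives_with x S p q :
  with_ok x -> apart [fset x] S ->
  derives ([fset child false x] `|` S) p -> derives ([fset child true x] `|` S) q ->
  derives ([fset x] `|` S) (PWith x p q).
Proof.
have c b : cmp x (child b x) by rewrite /cmp below_child.
case=> A [B e] h dp dq.
by apply: DWith e _ _ _ dp dq; rewrite ?(apart_notin _ h) ?cmp_refl ?c.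
Qed.

Lemma derives_split s S T p q :
  split_ok s -> apart (split_principal s) (S `|` T) -> apart S T ->
  derives (split_active false s `|` S) p ->
  derives (split_active true s `|` T) q ->
  derives (split_principal s `|` (S `|` T)) (PSplit s p q).
Proof.
case: s => [x|] /=; last first.
  by move=> m _ /apart_disjoint d; rewrite !fset0U; apply: DMix.
have c b : cmp x (child b x) by rewrite /cmp below_child.
case=> A [B e] h /apart_disjoint d dp dq.
have [hS hT] := (apartUr _ _ _).1 h.
by apply: DTensor e d _ _ _ dp dq;
  rewrite ?(apart_notin _ h) ?(apart_notin _ hS) ?(apart_notin _ hT) ?cmp_refl ?c.
Qed.

(** Beyond inverting the last rule, this and the next inversions hand the antichain invariant on to
    the premises and sharpen disjoint to incomparable. *)
Lemma derives_unP S u p : antichain S -> derives S (PUn u p) ->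
  exists T, [/\ S = [fset un_principal u] `|` T, un_ok u,
    apart [fset un_principal u] T, antichain (un_active u `|` T) &
    derives (un_active u `|` T) p].
Proof.
move=> aS d; move: aS.
inversion d as [|
  |x A B T p' e xT _ _ d'| |x A B T p' e xT _ d'|x A B T p' e xT _ d'|];
  subst => aS; exists T;
  have ap := apart1_children xT aS; split=> //=; try by (exists A, B).
all: try exact: antichain_premise (@children1 _ _) ap aS.
- exact: antichain_premise (@children_un (RPar x)) ap aS.
- by rewrite -fsetUA.
Qed.

Lemma derives_withP S x p q : antichain S -> derives S (PWith x p q) ->
  exists T, [/\ S = [fset x] `|` T, with_ok x, apart [fset x] T,
    forall b, antichain ([fset child b x] `|` T) &
    derives ([fset child false x] `|` T) p /\ derives ([fset child true x] `|` T) q].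
Proof.
move=> aS d; move: aS; inversion d as [| | |y A B T p' q' e xT _ _ dp dq| | |].
subst => aS; exists T; have ap := apart1_children xT aS; split=> //.
  by exists A, B.
by move=> b; exact: antichain_premise (@children1 _ _) ap aS.
Qed.

Lemma derives_splitP S s p q : antichain S -> derives S (PSplit s p q) ->
  exists T U, [/\ S = split_principal s `|` (T `|` U), split_ok s,
    apart (split_principal s) (T `|` U), apart T U &
    [/\ antichain (split_active false s `|` T),
        antichain (split_active true s `|` U),
        derives (split_active false s `|` T) p &
        derives (split_active true s `|` U) q]].
Proof.
move=> aS d; move: aS.
inversion d as [|x A B T U p' q' e dTU xTU _ _ dp dq| | | | |T U p' q' m dTU dp dq];
  subst => aS; exists T, U.
- have ap := apart1_children xTU aS.
  split=> //; first by exists A, B.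
    by apply: antichain_apart dTU; apply: antichain_sub aS _; rewrite fsubsetUr.
  have [aT aU] := (apartUr _ _ _).1 ap.
  split=> //.
    apply: antichain_premise (@children1 _ _) aT _.
    by apply: antichain_sub aS _; rewrite fsetUA fsubsetUl.
  apply: antichain_premise (@children1 _ _) aU _.
  by apply: antichain_sub aS _; rewrite fsetUS ?fsubsetUr.
- rewrite /= !fset0U; split=> //; first exact: antichain_apart.
  split=> //; apply: antichain_sub aS _; by rewrite ?fsubsetUl ?fsubsetUr.
Qed.

Lemma derives_axP S x y : derives S (PAx x y) ->
  S = [fset x; y] /\ exists P, subform G x = Some (Var P) /\ subform G y = Some (NVar P).
Proof.
by move=> d; inversion d as [x' y' P ex ey| | | | | |]; subst; split=> //; exists P.
Qed.

(** There is no proof of the empty sequent: this makes the premises of a mix strictly smaller than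
    its conclusion, and ties the presence of an optional proof to its sequent being nonempty. *)
Lemma derives_neq0 S p : derives S p -> S != fset0.
Proof.
elim=> {S p} [x y P _ _|x *|x *|x *|x *|x *|S T p q _ _ _ + _ _];
  try by (apply/fset0Pn; exists x; rewrite !inE eqxx).
by case/fset0Pn=> x xS; apply/fset0Pn; exists x; rewrite inE xS.
Qed.

End Derivations.

(** * Linkings *)

Lemma in_fset_sep (K : choiceType) (A : {fset K}) (P : pred K) k :
  (k \in [fset x in A | P x]) = (k \in A) && P k.
Proof. by rewrite !inE. Qed.

Lemma translation_ax x y : translation (PAx x y) = [fset [fset [fset x; y]]].
Proof. by apply/fsetP => l; rewrite /translation /= !in_fset. Qed.

Lemma in_translation p l :
  (l \in translation p) = (l \in [seq linking_of R | R <- resolutions p]).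
Proof. by rewrite /translation in_fset. Qed.

Lemma translation_un u p : translation (PUn u p) = translation p.
Proof. by apply/fsetP => l; rewrite !in_translation /= -map_comp. Qed.

Lemma translation_with x p q :
  translation (PWith x p q) = translation p `|` translation q.
Proof.
apply/fsetP => l; rewrite in_fsetU !in_translation /= map_cat mem_cat.
by rewrite -!map_comp.
Qed.

Lemma translation_splitP s p q l :
  reflect (exists2 l1, l1 \in translation p &
             exists2 l2, l2 \in translation q & l = l1 `|` l2)
          (l \in translation (PSplit s p q)).
Proof.
rewrite in_translation /=.
have -> : [seq linking_of R | R <- [seq ResSplit s R R' | R <- resolutions p,
                                                       R' <- resolutions q]] =
    [seq l1 `|` l2 | l1 <- [seq linking_of R | R <- resolutions p],
                     l2 <- [seq linking_of R | R <- resolutions q]].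
  by rewrite map_allpairs allpairs_mapl; elim: (resolutions p) => //= R r ->;
     rewrite -map_comp.
apply: (iffP allpairsP) => [[[l1 l2] /= [h1 h2 ->]]|[l1 h1 [l2 h2 ->]]].
  by exists l1; rewrite ?in_translation //; exists l2; rewrite ?in_translation.
by exists (l1, l2); rewrite -!in_translation.
Qed.

Lemma translation_split s p p' q q' :
  translation p = translation p' -> translation q = translation q' ->
  forall s', translation (PSplit s p q) = translation (PSplit s' p' q').
Proof.
move=> hp hq s'; apply/fsetP => l.
by apply/translation_splitP/translation_splitP; rewrite hp hq.
Qed.

Lemma translation_neq0 p : exists l, l \in translation p.
Proof.
elim: p => [x y|u p [l hl]|s p [l hl] q [m hm]|x p [l hl] q _].
- by eexists; rewrite translation_ax inE.
- by exists l; rewrite translation_un.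
- by exists (l `|` m); apply/translation_splitP; exists l => //; exists m.
- by exists l; rewrite translation_with inE hl.
Qed.

Lemma in_translation_split s p q l m :
  l \in translation p -> m \in translation q ->
  l `|` m \in translation (PSplit s p q).
Proof. by move=> hl hm; apply/translation_splitP; exists l => //; exists m. Qed.

Lemma translation_splitC s p q :
  translation (PSplit s p q) = translation (PSplit s q p).
Proof.
by apply/fsetP => l; apply/translation_splitP/translation_splitP;
  case=> m hm [n hn ->]; exists n => //; exists m => //; rewrite fsetUC.
Qed.

Lemma translation_splitA s t s' t' p q r :
  translation (PSplit s p (PSplit t q r)) =
  translation (PSplit t' (PSplit s' p q) r).
Proof.
apply/fsetP => l; apply/translation_splitP/translation_splitP.
  case=> a ha [bc /translation_splitP[b hb [c hc ->]] ->].
  exists (a `|` b); first exact: in_translation_split.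
  by exists c; rewrite ?fsetUA.
case=> ab /translation_splitP[a ha [b hb ->]] [c hc ->].
by exists a => //; exists (b `|` c); rewrite ?fsetUA ?in_translation_split.
Qed.

Lemma translation_split_withl s x p q r :
  translation (PSplit s (PWith x p q) r) =
  translation (PWith x (PSplit s p r) (PSplit s q r)).
Proof.
apply/fsetP => l; rewrite translation_with in_fsetU.
apply/translation_splitP/orP.
  case=> a; rewrite translation_with in_fsetU => /orP[] ha [b hb ->];
  by [left; apply: in_translation_split|right; apply: in_translation_split].
by case=> /translation_splitP[a ha [b hb ->]]; exists a;
  rewrite ?translation_with ?in_fsetU ?ha ?orbT //; exists b.
Qed.

Lemma transpose_translation p q : transpose p q -> translation p = translation q.
Proof.
have C := translation_splitC; have A := translation_splitA.
case=> {p q} [u v p|s u p q|s u p q|x u p q|s t p q r|s t p q r|s t p q r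
  |s x p q r|s x p q r|x y p q r w]; rewrite ?translation_un //.
- by apply: translation_split; rewrite ?translation_un.
- by apply: translation_split; rewrite ?translation_un.
- by rewrite !translation_with !translation_un.
(* Both sides are reassociated until [p] and [q] meet in one split, where they can be swapped. *)
- rewrite (A s t s t) (A t s t s).
  by apply: translation_split => //; rewrite C; apply: translation_split.
- rewrite -(A t s t s) -(A s t s t).
  by apply: translation_split => //; rewrite C; apply: translation_split.
- exact: translation_split_withl.
- by rewrite C translation_split_withl !translation_with -!(C s p).
- by rewrite !translation_with fsetUACA.
Qed.

Lemma convertible_translation V mix (G : seq (form V)) p q :
  convertible mix G p q -> translation p = translation q.
Proof.
elim=> {p q} [p q c|//|//|p q r _ -> _ -> //].
elim: c => {p q} [S p q /transpose_translation //|p q|u p q _ h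
  |s p p' q _ h|s p q q' _ h|x p p' q _ h|x p q q' _ h].
- exact: translation_splitC.
- by rewrite !translation_un.
- exact: translation_split.
- exact: translation_split.
- by rewrite !translation_with h.
- by rewrite !translation_with h.
Qed.

Definition under (S : sequent) (v : vertex) : bool := has (below^~ v) S.

Lemma underP S v : reflect (exists2 u, u \in S & below u v) (under S v).
Proof. exact: hasP. Qed.

(** For [u] a child of an additive formula, this tells whether the linking has chosen that
    argument. *)
Definition touches (u : vertex) (l : linking) : bool :=
  has (fun k : link => has (below u) k) l.

Lemma touchesP u (l : linking) :
  reflect (exists (k : link) v, [/\ k \in l, v \in k & below u v]) (touches u l).
Proof.
apply: (iffP hasP) => [[k kl /hasP[v vk uv]]|[k [v [kl vk uv]]]].
  by exists k, v.
by exists k => //; apply/hasP; exists v.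
Qed.

(** An empty link would lie vacuously inside any set of vertices, hence on both sides of a split and
    in both colours; this is why it is excluded. *)
Definition covers (S : sequent) (l : linking) : Prop :=
  forall k, k \in l -> k != fset0 /\ forall v, v \in k -> under S v.

Lemma coversW S T l : (forall u, u \in S -> under T u) -> covers S l -> covers T l.
Proof.
move=> h hl k /hl[k0 kS]; split=> // v /kS /underP[u /h /underP[w wT wu] uv].
by apply/underP; exists w => //; apply: below_trans uv.
Qed.

Lemma touches_below x y l : below x y -> touches y l -> touches x l.
Proof.
move=> h /touchesP[k [v [kl vk yv]]]; apply/touchesP; exists k, v.
by split=> //; apply: below_trans yv.
Qed.

Lemma touchesU x l m : touches x (l `|` m) = touches x l || touches x m.
Proof.
apply/touchesP/orP => [[k [v []]]|].
  rewrite inE => /orP[] kl vk xv; [left|right]; apply/touchesP; by exists k, v.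
by case=> /touchesP[k [v [kl vk xv]]]; exists k, v; rewrite inE kl ?orbT.
Qed.

Lemma under_sub S T v : S `<=` T -> under S v -> under T v.
Proof. by move=> /fsubsetP sT /underP[u /sT uT uv]; apply/underP; exists u. Qed.

Lemma under1 x v : under [fset x] v = below x v.
Proof.
apply/underP/idP => [[u]|h]; first by rewrite inE => /eqP->.
by exists x; rewrite ?inE.
Qed.

Lemma underU S T v : under (S `|` T) v = under S v || under T v.
Proof.
apply/underP/orP => [[u]|].
  by rewrite inE => /orP[] uS uv; [left|right]; apply/underP; exists u.
by case=> /underP[u uS uv]; exists u; rewrite // inE uS ?orbT.
Qed.

Lemma underS S v : v \in S -> under S v.
Proof. by move=> h; apply/underP; exists v; rewrite ?below_refl. Qed.

(** A leaf with both [x] and a vertex of [S] as ancestors would make these comparable. This is how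
    an additive argument is seen not to be chosen. *)
Lemma not_touches x S l : apart [fset x] S -> covers S l -> ~~ touches x l.
Proof.
move=> h c; apply/touchesP => -[k [v [/c[_ kS] vk xv]]].
have /underP[u uS uv] := kS v vk.
by have := h x u; rewrite inE eqxx uS (below_cmp xv uv) => /(_ isT isT).
Qed.

Lemma covers_sub S T l : S `<=` T -> covers S l -> covers T l.
Proof.
by move=> h; apply: coversW => u uS; apply: under_sub h _; apply: underS.
Qed.

Lemma coversU S l m : covers S l -> covers S m -> covers S (l `|` m).
Proof. by move=> hl hm k; rewrite inE => /orP[/hl|/hm]. Qed.

Section Linkings.

Variables (V : Type) (mix : bool) (G : seq (form V)).

Notation derives := (derives mix G).

Lemma derives_covers S p l : derives S p -> l \in translation p -> covers S l.
Proof.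
have c b x T u : u \in child b x |` T -> under (x |` T) u.
  rewrite underU under1 inE => /orP[|/underS->]; rewrite ?orbT //.
  by rewrite inE => /eqP->; rewrite below_child.
have c2 x T u : u \in lchild x |` (rchild x |` T) -> under (x |` T) u.
  rewrite inE => /orP[|/c //]; rewrite inE underU under1 => /eqP->.
  by rewrite below_child.
move=> d; elim: d l => {S p} [x y P _ _|x A B S T p q _ _ _ _ _ _ Hp _ Hq
  |x A B S p _ _ _ _ _ H|x A B S p q _ _ _ _ _ Hp _ Hq
  |x A B S p _ _ _ _ H|x A B S p _ _ _ _ H|S T p q _ _ _ Hp _ Hq] l.
- rewrite translation_ax inE => /eqP-> k; rewrite inE => /eqP->; split.
    by apply/fset0Pn; exists x; rewrite !inE eqxx.
  by move=> v vk; apply: underS.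
- case/translation_splitP => m /Hp hm [n /Hq hn ->]; apply: coversU.
    apply: coversW hm => u /c; apply: under_sub.
    by rewrite fsetUA fsubsetUl.
  apply: coversW hn => u /c; apply: under_sub.
  by rewrite fsetUS ?fsubsetUr.
- by rewrite translation_un => /H; apply: coversW; exact: c2.
- rewrite translation_with inE => /orP[/Hp|/Hq]; apply: coversW; exact: c.
- by rewrite translation_un => /H; apply: coversW; exact: c.
- by rewrite translation_un => /H; apply: coversW; exact: c.
- case/translation_splitP => m /Hp hm [n /Hq hn ->]; apply: coversU.
    by apply: covers_sub hm; rewrite fsubsetUl.
  by apply: covers_sub hn; rewrite fsubsetUr.
Qed.

(** There is no weakening, so every resolution leads each formula of the conclusion down from some
    axiom. *)
Lemma derives_touches S p l u :
  derives S p -> l \in translation p -> u \in S -> touches u l.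
Proof.
have c b x T l' : (forall u, u \in child b x |` T -> touches u l') ->
    forall u, u \in x |` T -> touches u l'.
  move=> h v; rewrite inE => /orP[|vT]; last by apply: h; rewrite inE vT orbT.
  rewrite inE => /eqP->; apply: (touches_below (below_child b x)); apply: h.
  by rewrite !inE eqxx.
move=> d; elim: d l u => {S p} [x y P _ _|x A B S T p q _ _ _ _ _ _ Hp _ Hq
  |x A B S p _ _ _ _ _ H|x A B S p q _ _ _ _ _ Hp _ Hq
  |x A B S p _ _ _ _ H|x A B S p _ _ _ _ H|S T p q _ _ _ Hp _ Hq] l.
- move=> u; rewrite translation_ax inE => /eqP-> uS; apply/touchesP.
  by exists [fset x; y], u; split; rewrite ?below_refl // inE.
- move=> u /translation_splitP[m /Hp h1 [n /Hq h2 ->]].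
  have hm := c false x S m h1; have hn := c true x T n h2.
  rewrite touchesU fsetUA inE => /orP[/hm-> //|uT].
  by rewrite hn ?orbT // inE uT orbT.
- move=> u; rewrite translation_un => /H h uS.
  apply: (c false x S l _ u uS) => w; rewrite inE => /orP[wx|wS].
    by apply: h; rewrite inE wx.
  by apply: h; rewrite !inE wS !orbT.
- move=> u; rewrite translation_with inE => /orP[/Hp h|/Hq h].
    exact: c false x S l h u.
  exact: c true x S l h u.
- move=> u; rewrite translation_un => /H h; exact: c false x S l h u.
- move=> u; rewrite translation_un => /H h; exact: c true x S l h u.
- move=> u /translation_splitP[m /Hp hm [n /Hq hn ->]].
  by rewrite touchesU inE => /orP[/hm->|/hn->]; rewrite ?orbT.
Qed.

(** A linking from the left premise reaches the left child of [x], one from the right premise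
    cannot. So the linkings of a proof ending with a & determine those of its premises. *)
Lemma with_translationl x S p q : antichain S -> derives S (PWith x p q) ->
  translation p =
    [fset l in translation (PWith x p q) | touches (child false x) l].
Proof.
move=> aS /(derives_withP aS)[T [eS _ ap _ [dp dq]]].
rewrite translation_with; apply/fsetP => l; rewrite in_fset_sep in_fsetU.
apply/idP/andP => [h|[/orP[//|h]]].
  by rewrite h (derives_touches dp h) // !inE eqxx.
apply: contraTT => _; apply: not_touches (derives_covers dq h).
apply/apartUr; split; last exact: apart_children (@children1 _ _) ap.
by move=> u v; rewrite !inE => /eqP-> /eqP->; apply/negP => /cmp_children.
Qed.

Lemma with_translationr x S p q : antichain S -> derives S (PWith x p q) ->
  translation q =
    [fset l in translation (PWith x p q) | touches (child true x) l].
Proof.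
move=> aS /(derives_withP aS)[T [eS _ ap _ [dp dq]]].
rewrite translation_with; apply/fsetP => l; rewrite in_fset_sep in_fsetU.
apply/idP/andP => [h|[/orP[h|//]]].
  by rewrite h orbT (derives_touches dq h) // !inE eqxx.
apply: contraTT => _; apply: not_touches (derives_covers dp h).
apply/apartUr; split; last exact: apart_children (@children1 _ _) ap.
by move=> u v; rewrite !inE => /eqP-> /eqP->; apply/negP => /cmp_children.
Qed.

End Linkings.

(** * Commutations *)

Lemma apart_child b x S : apart [fset x] S -> apart [fset child b x] S.
Proof. exact: apart_children (@children1 b x). Qed.

(** The sequent identities met in commutations involve only unions, so they are propositional
    tautologies about the membership of one vertex. *)
Ltac fset_ac :=
  let z := fresh "z" in
  apply/fsetP => z; rewrite ?in_fsetU ?in_fset0;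
  by repeat match goal with
    |- context [@in_mem ?T z ?A] => generalize (@in_mem T z A); case end.

Ltac apart_tac := lazymatch goal with
  | |- apart (_ `|` _) _ => apply/apartUl; split; apart_tac
  | |- apart _ (_ `|` _) => apply/apartUr; split; apart_tac
  | |- apart (split_active _ ?s) (split_active _ ?s) =>
      first [exact: apart_split_active | apply: apartC; exact: apart_split_active]
  | |- apart fset0 _ => exact: apart0l
  | |- apart _ fset0 => exact: apart0r
  | |- apart (un_active _) _ => apply: apart_un; apart_tac
  | |- apart _ (un_active _) => apply: apartC; apply: apart_un; apart_tac
  | |- apart (split_active _ _) _ => apply: apart_split; apart_tac
  | |- apart _ (split_active _ _) => apply: apartC; apply: apart_split; apart_tac
  | |- apart [fset child _ _] _ => apply: apart_child; apart_tac
  | |- apart _ [fset child _ _] => apply: apartC; apply: apart_child; apart_tac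
  | |- apart ?S ?T => match goal with
      | h : apart S T |- _ => exact: h
      | h : apart T S |- _ => exact: (apartC h)
      | _ => first [assumption | apply: apartC; assumption]
      end
  end.

Section Commutations.

Variables (V : Type) (mix : bool) (G : seq (form V)).

Notation derives := (derives mix G).
Notation conv := (convertible mix G).
Notation split_ok := (split_ok mix G).
Notation un_ok := (un_ok G).
Notation with_ok := (with_ok G).

(** Conversion is kept together with the sequent proved at both ends, since [CHere] asks for
    derivations of both sides at each transposition. *)
Definition equiv (S : sequent) (p q : proof) :=
  [/\ derives S p, derives S q & conv p q].

Lemma equiv_refl S p : derives S p -> equiv S p p.
Proof. by move=> h; split=> //; apply: rst_refl. Qed.

Lemma equiv_sym S p q : equiv S p q -> equiv S q p.
Proof. by case=> hp hq c; split=> //; apply: rst_sym. Qed.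

Lemma equiv_trans S p q r : equiv S p q -> equiv S q r -> equiv S p r.
Proof. by case=> hp _ c [_ hr c']; split=> //; apply: rst_trans c'. Qed.

Lemma conv_lift (f : proof -> proof) p q :
  (forall p q, commutation mix G p q -> commutation mix G (f p) (f q)) ->
  conv p q -> conv (f p) (f q).
Proof.
move=> h; elim=> {p q} [p q c|p|p q _|p q r _ h1 _ h2].
- by apply: rst_step; apply: h.
- exact: rst_refl.
- exact: rst_sym.
- exact: rst_trans h1 h2.
Qed.

Lemma equiv_un S T u p q :
  T = [fset un_principal u] `|` S -> un_ok u -> apart [fset un_principal u] S ->
  equiv (un_active u `|` S) p q -> equiv T (PUn u p) (PUn u q).
Proof.
move=> -> ok ap [hp hq c]; split; try exact: derives_un.
by apply: conv_lift c => p' q'; apply: CUn.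
Qed.

Lemma equiv_with S T x p p' q q' :
  T = [fset x] `|` S -> with_ok x -> apart [fset x] S ->
  equiv ([fset child false x] `|` S) p p' ->
  equiv ([fset child true x] `|` S) q q' ->
  equiv T (PWith x p q) (PWith x p' q').
Proof.
move=> -> ok ap [hp hp' c] [hq hq' c']; split; try exact: derives_with.
apply: (@rst_trans _ _ _ (PWith x p' q)).
  by apply: (conv_lift (f := fun p => PWith x p q)) c => r r'; apply: CWithL.
by apply: conv_lift c' => r r'; apply: CWithR.
Qed.

Lemma equiv_split S T U s p p' q q' :
  U = split_principal s `|` (S `|` T) -> split_ok s ->
  apart (split_principal s) (S `|` T) -> apart S T ->
  equiv (split_active false s `|` S) p p' ->
  equiv (split_active true s `|` T) q q' ->
  equiv U (PSplit s p q) (PSplit s p' q').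
Proof.
move=> -> ok ap ap' [hp hp' c] [hq hq' c']; split; try exact: derives_split.
apply: (@rst_trans _ _ _ (PSplit s p' q)).
  by apply: (conv_lift (f := fun p => PSplit s p q)) c => r r'; apply: CSplitL.
by apply: conv_lift c' => r r'; apply: CSplitR.
Qed.

Lemma equiv_transpose S p q :
  transpose p q -> derives S p -> derives S q -> equiv S p q.
Proof. by move=> t hp hq; split=> //; apply: rst_step; apply: CHere t hp hq. Qed.

Lemma derives_eq S T p : derives S p -> T = S -> derives T p.
Proof. by move=> h ->. Qed.

Lemma equiv_eq S T p q : equiv S p q -> T = S -> equiv T p q.
Proof. by move=> h ->. Qed.

Lemma derives_unE S T u p :
  T = [fset un_principal u] `|` S -> un_ok u -> apart [fset un_principal u] S ->
  derives (un_active u `|` S) p -> derives T (PUn u p).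
Proof. by move=> ->; apply: derives_un. Qed.

Lemma derives_withE S T x p q :
  T = [fset x] `|` S -> with_ok x -> apart [fset x] S ->
  derives ([fset child false x] `|` S) p -> derives ([fset child true x] `|` S) q ->
  derives T (PWith x p q).
Proof. by move=> ->; apply: derives_with. Qed.

Lemma derives_splitE S T U s p q :
  U = split_principal s `|` (S `|` T) -> split_ok s ->
  apart (split_principal s) (S `|` T) -> apart S T ->
  derives (split_active false s `|` S) p ->
  derives (split_active true s `|` T) q -> derives U (PSplit s p q).
Proof. by move=> ->; apply: derives_split. Qed.

Ltac side := lazymatch goal with
  | |- apart _ _ => by apart_tac
  | |- Defs.derives _ _ _ ?p =>
      first [assumption | match goal with h : Defs.derives _ _ _ p |- _ =>
        by apply: (derives_eq h); fset_ac end]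
  | e : ?S = ?T |- ?S = ?T => exact: e
  | |- _ = _ => by fset_ac
  | |- _ => assumption
  end.

(** In this and the following transpositions the sequent is cut into principal formulas and
    contexts; their pairwise incomparability yields the side conditions of both derivations. *)
Lemma equiv_un_un S T u v p : S = [fset un_principal u] `|` ([fset un_principal v] `|` T) ->
  un_ok u -> un_ok v -> apart [fset un_principal u] [fset un_principal v] ->
  apart [fset un_principal u] T -> apart [fset un_principal v] T ->
  derives (un_active u `|` (un_active v `|` T)) p ->
  equiv S (PUn u (PUn v p)) (PUn v (PUn u p)).
Proof.
move=> -> oku okv uv uT vT d; apply: equiv_transpose; first exact: TUnUn.
  apply: (@derives_unE ([fset un_principal v] `|` T)); try side.
  by apply: (@derives_unE (un_active u `|` T)); side.
apply: (@derives_unE ([fset un_principal u] `|` T)); try side.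
by apply: (@derives_unE (un_active v `|` T)); side.
Qed.

Lemma equiv_with_un S T x u p q : S = [fset x] `|` ([fset un_principal u] `|` T) ->
  with_ok x -> un_ok u -> apart [fset x] [fset un_principal u] ->
  apart [fset x] T -> apart [fset un_principal u] T ->
  derives ([fset child false x] `|` (un_active u `|` T)) p ->
  derives ([fset child true x] `|` (un_active u `|` T)) q ->
  equiv S (PWith x (PUn u p) (PUn u q)) (PUn u (PWith x p q)).
Proof.
move=> -> okx oku xu xT uT dp dq; apply: equiv_transpose; first exact: TWithUn.
  apply: (@derives_withE ([fset un_principal u] `|` T)); try side.
    by apply: (@derives_unE ([fset child false x] `|` T)); side.
  by apply: (@derives_unE ([fset child true x] `|` T)); side.
apply: (@derives_unE ([fset x] `|` T)); try side.
by apply: (@derives_withE (un_active u `|` T)); side.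
Qed.

Lemma equiv_with_with S T x y p q r w : S = [fset x] `|` ([fset y] `|` T) ->
  with_ok x -> with_ok y -> apart [fset x] [fset y] ->
  apart [fset x] T -> apart [fset y] T ->
  derives ([fset child false x] `|` ([fset child false y] `|` T)) p ->
  derives ([fset child false x] `|` ([fset child true y] `|` T)) q ->
  derives ([fset child true x] `|` ([fset child false y] `|` T)) r ->
  derives ([fset child true x] `|` ([fset child true y] `|` T)) w ->
  equiv S (PWith x (PWith y p q) (PWith y r w)) (PWith y (PWith x p r) (PWith x q w)).
Proof.
move=> -> okx oky xy xT yT dp dq dr dw.
apply: equiv_transpose; first exact: TWithWith.
  apply: (@derives_withE ([fset y] `|` T)); try side.
    by apply: (@derives_withE ([fset child false x] `|` T)); side.
  by apply: (@derives_withE ([fset child true x] `|` T)); side.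
apply: (@derives_withE ([fset x] `|` T)); try side.
  by apply: (@derives_withE ([fset child false y] `|` T)); side.
by apply: (@derives_withE ([fset child true y] `|` T)); side.
Qed.

Lemma equiv_split_unl S T U s u p q :
  S = split_principal s `|` ([fset un_principal u] `|` T `|` U) ->
  split_ok s -> un_ok u ->
  apart (split_principal s) [fset un_principal u] ->
  apart (split_principal s) T -> apart (split_principal s) U ->
  apart [fset un_principal u] T -> apart [fset un_principal u] U -> apart T U ->
  derives (split_active false s `|` (un_active u `|` T)) p ->
  derives (split_active true s `|` U) q ->
  equiv S (PSplit s (PUn u p) q) (PUn u (PSplit s p q)).
Proof.
move=> -> oks oku su sT sU uT uU TU dp dq.
apply: equiv_transpose; first exact: TSplitUnL.
  apply: (@derives_splitE ([fset un_principal u] `|` T) U); try side.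
  by apply: (@derives_unE (split_active false s `|` T)); side.
apply: (@derives_unE (split_principal s `|` (T `|` U))); try side.
by apply: (@derives_splitE (un_active u `|` T) U); side.
Qed.

Lemma equiv_split_unr S T U s u p q :
  S = split_principal s `|` (T `|` ([fset un_principal u] `|` U)) ->
  split_ok s -> un_ok u ->
  apart (split_principal s) [fset un_principal u] ->
  apart (split_principal s) T -> apart (split_principal s) U ->
  apart [fset un_principal u] T -> apart [fset un_principal u] U -> apart T U ->
  derives (split_active false s `|` T) p ->
  derives (split_active true s `|` (un_active u `|` U)) q ->
  equiv S (PSplit s p (PUn u q)) (PUn u (PSplit s p q)).
Proof.
move=> -> oks oku su sT sU uT uU TU dp dq.
apply: equiv_transpose; first exact: TSplitUnR.
  apply: (@derives_splitE T ([fset un_principal u] `|` U)); try side.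
  by apply: (@derives_unE (split_active true s `|` U)); side.
apply: (@derives_unE (split_principal s `|` (T `|` U))); try side.
by apply: (@derives_splitE T (un_active u `|` U)); side.
Qed.

Lemma equiv_split_withl S T U s x p q r :
  S = split_principal s `|` ([fset x] `|` T `|` U) ->
  split_ok s -> with_ok x -> apart (split_principal s) [fset x] ->
  apart (split_principal s) T -> apart (split_principal s) U ->
  apart [fset x] T -> apart [fset x] U -> apart T U ->
  derives (split_active false s `|` ([fset child false x] `|` T)) p ->
  derives (split_active false s `|` ([fset child true x] `|` T)) q ->
  derives (split_active true s `|` U) r ->
  equiv S (PSplit s (PWith x p q) r) (PWith x (PSplit s p r) (PSplit s q r)).
Proof.
move=> -> oks okx sx sT sU xT xU TU dp dq dr.
apply: equiv_transpose; first exact: TSplitWithL.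
  apply: (@derives_splitE ([fset x] `|` T) U); try side.
  by apply: (@derives_withE (split_active false s `|` T)); side.
apply: (@derives_withE (split_principal s `|` (T `|` U))); try side.
  by apply: (@derives_splitE ([fset child false x] `|` T) U); side.
by apply: (@derives_splitE ([fset child true x] `|` T) U); side.
Qed.

Lemma equiv_split_withr S T U s x p q r :
  S = split_principal s `|` (T `|` ([fset x] `|` U)) ->
  split_ok s -> with_ok x -> apart (split_principal s) [fset x] ->
  apart (split_principal s) T -> apart (split_principal s) U ->
  apart [fset x] T -> apart [fset x] U -> apart T U ->
  derives (split_active false s `|` T) p ->
  derives (split_active true s `|` ([fset child false x] `|` U)) q ->
  derives (split_active true s `|` ([fset child true x] `|` U)) r ->
  equiv S (PSplit s p (PWith x q r)) (PWith x (PSplit s p q) (PSplit s p r)).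
Proof.
move=> -> oks okx sx sT sU xT xU TU dp dq dr.
apply: equiv_transpose; first exact: TSplitWithR.
  apply: (@derives_splitE T ([fset x] `|` U)); try side.
  by apply: (@derives_withE (split_active true s `|` U)); side.
apply: (@derives_withE (split_principal s `|` (T `|` U))); try side.
  by apply: (@derives_splitE T ([fset child false x] `|` U)); side.
by apply: (@derives_splitE T ([fset child true x] `|` U)); side.
Qed.

Section SplitSplit.

Variables (S T U W : sequent) (s t : split_rule) (p q r : proof).
Hypothesis eW : W = split_principal s `|` (split_principal t `|` (S `|` (T `|` U))).
Hypotheses (oks : split_ok s) (okt : split_ok t).
Hypotheses (st : apart (split_principal s) (split_principal t))
  (sS : apart (split_principal s) S) (sT : apart (split_principal s) T)
  (sU : apart (split_principal s) U) (tS : apart (split_principal t) S)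
  (tT : apart (split_principal t) T) (tU : apart (split_principal t) U)
  (ST : apart S T) (SU : apart S U) (TU : apart T U).

(** The letters tell which premise of [s], then of [t], the shared subproof is. The fourth
    combination is the case RL read backwards. *)
Lemma equiv_split_split_LL :
  derives (split_active false s `|` (split_active false t `|` S)) p ->
  derives (split_active true t `|` T) q ->
  derives (split_active true s `|` U) r ->
  equiv W (PSplit s (PSplit t p q) r) (PSplit t (PSplit s p r) q).
Proof.
move=> dp dq dr; rewrite eW; apply: equiv_transpose; first exact: TSplitSplitLL.
  apply: (@derives_splitE (split_principal t `|` (S `|` T)) U); try side.
  by apply: (@derives_splitE (split_active false s `|` S) T); side.
apply: (@derives_splitE (split_principal s `|` (S `|` U)) T); try side.
by apply: (@derives_splitE (split_active false t `|` S) U); side.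
Qed.

Lemma equiv_split_split_RL :
  derives (split_active false s `|` S) p ->
  derives (split_active true s `|` (split_active false t `|` T)) q ->
  derives (split_active true t `|` U) r ->
  equiv W (PSplit s p (PSplit t q r)) (PSplit t (PSplit s p q) r).
Proof.
move=> dp dq dr; rewrite eW; apply: equiv_transpose; first exact: TSplitSplitRL.
  apply: (@derives_splitE S (split_principal t `|` (T `|` U))); try side.
  by apply: (@derives_splitE (split_active true s `|` T) U); side.
apply: (@derives_splitE (split_principal s `|` (S `|` T)) U); try side.
by apply: (@derives_splitE S (split_active false t `|` T)); side.
Qed.

Lemma equiv_split_split_RR :
  derives (split_active false s `|` S) p ->
  derives (split_active false t `|` T) q ->
  derives (split_active true s `|` (split_active true t `|` U)) r ->
  equiv W (PSplit s p (PSplit t q r)) (PSplit t q (PSplit s p r)).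
Proof.
move=> dp dq dr; rewrite eW; apply: equiv_transpose; first exact: TSplitSplitRR.
  apply: (@derives_splitE S (split_principal t `|` (T `|` U))); try side.
  by apply: (@derives_splitE T (split_active true s `|` U)); side.
apply: (@derives_splitE T (split_principal s `|` (S `|` U))); try side.
by apply: (@derives_splitE S (split_active true t `|` U)); side.
Qed.

End SplitSplit.

End Commutations.

(* Mixing with an optional proof: [None] stands for a proof of the empty
   sequent, so that a separation with an empty side needs no mix rule. *)
Definition mix_opt (d : option proof) (p : proof) : proof :=
  if d is Some q then PSplit RMix q p else p.

Definition mix_opts (d e : option proof) : option proof :=
  if e is Some p then Some (mix_opt d p) else d.

Section OptionalMix.

Variables (V : Type) (mix : bool) (G : seq (form V)).

Notation derives := (derives mix G).
Notation split_ok := (split_ok mix G).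
Notation un_ok := (un_ok G).
Notation with_ok := (with_ok G).
Notation equiv := (equiv mix G).

Definition derives_opt (S : sequent) (d : option proof) : Prop :=
  if d is Some p then derives S p else S = fset0.

Definition mixable (d : option proof) : Prop := isSome d -> mix.

Ltac side := lazymatch goal with
  | |- apart _ _ => by apart_tac
  | |- Defs.derives _ _ _ ?p =>
      first [assumption | match goal with h : Defs.derives _ _ _ p |- _ =>
        by apply: (derives_eq h); fset_ac end]
  | e : ?S = ?T |- ?S = ?T => exact: e
  | |- _ = _ => by fset_ac
  | |- _ => assumption
  end.

Lemma derives_mix_opt S T U d p : U = S `|` T ->
  mixable d -> apart S T -> derives_opt S d -> derives T p ->
  derives U (mix_opt d p).
Proof.
move=> ->; case: d => /= [q m ap hq hp|_ _ ->]; last by rewrite fset0U.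
by apply: DMix => //; [exact: m|exact: apart_disjoint].
Qed.

Lemma equiv_mix_opt S T U d p q : U = S `|` T ->
  mixable d -> apart S T -> derives_opt S d ->
  equiv T p q -> equiv U (mix_opt d p) (mix_opt d q).
Proof.
move=> ->; case: d => /= [r m ap hr e|_ _ ->]; last by rewrite fset0U.
apply: (@equiv_split _ _ _ S T) => //=; try side.
- exact: m.
- by rewrite fset0U; apply: equiv_refl.
- by rewrite fset0U.
Qed.

Lemma equiv_mixC S T U p q : U = S `|` T -> mix -> apart S T ->
  derives S p -> derives T q -> equiv U (PSplit RMix p q) (PSplit RMix q p).
Proof.
move=> -> m /apart_disjoint ap hp hq; split; first exact: DMix.
  by rewrite fsetUC; apply: DMix; rewrite // fdisjoint_sym.
by apply: rst_step; apply: CMixC.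
Qed.

Lemma derives_mix_opts S T U d e : U = S `|` T ->
  mixable e -> mixable d -> apart S T ->
  derives_opt S d -> derives_opt T e -> derives_opt U (mix_opts d e).
Proof.
move=> ->; case: e => [p me md ap hd he|_ _ _ hd ->]; last by rewrite fsetU0.
exact: derives_mix_opt hd he.
Qed.

Lemma mixable_opts d e : mixable d -> mixable e -> mixable (mix_opts d e).
Proof. by case: e. Qed.

Lemma equiv_mix_optA S T U W d e p : W = S `|` (T `|` U) ->
  mixable d -> mixable e -> apart S T -> apart S U -> apart T U ->
  derives_opt S d -> derives_opt T e -> derives U p ->
  equiv W (mix_opt d (mix_opt e p)) (mix_opt (mix_opts d e) p).
Proof.
move=> eW md me ST SU TU hd he hp.
have h : derives W (mix_opt d (mix_opt e p)).
  apply: (@derives_mix_opt S (T `|` U)) => //; first by apart_tac.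
  exact: derives_mix_opt he hp.
case: e me he h => [r /= me hr|_ _]; last by move=> h; apply: equiv_refl.
case: d md hd => [q /= md hq _|_ _]; last by move=> h; apply: equiv_refl.
by apply: (@equiv_split_split_RL _ _ _ S T U) => //=;
  rewrite ?fset0U //; try side; exact: me.
Qed.

Lemma equiv_mix_opt_un S T D u d p : S = D `|` ([fset un_principal u] `|` T) ->
  un_ok u -> mixable d -> apart [fset un_principal u] D ->
  apart [fset un_principal u] T -> apart D T ->
  derives_opt D d -> derives (un_active u `|` T) p ->
  equiv S (PUn u (mix_opt d p)) (mix_opt d (PUn u p)).
Proof.
move=> -> ok; case: d => [q /= m uD uT DT hq hp|_ _ uT _ -> hp]; last first.
  by rewrite fset0U; apply: equiv_refl; apply: derives_un.
apply: equiv_sym; apply: (@equiv_split_unr _ _ _ _ D T) => //=;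
  rewrite ?fset0U //; try side; exact: m.
Qed.

Lemma equiv_mix_opt_with S T D x d p q : S = D `|` ([fset x] `|` T) ->
  with_ok x -> mixable d -> apart [fset x] D -> apart [fset x] T -> apart D T ->
  derives_opt D d -> derives ([fset child false x] `|` T) p ->
  derives ([fset child true x] `|` T) q ->
  equiv S (PWith x (mix_opt d p) (mix_opt d q)) (mix_opt d (PWith x p q)).
Proof.
move=> -> ok; case: d => [r /= m uD uT DT hr hp hq|_ _ uT _ -> hp hq]; last first.
  by rewrite fset0U; apply: equiv_refl; apply: derives_with.
apply: equiv_sym; apply: (@equiv_split_withr _ _ _ _ D T) => //=;
  rewrite ?fset0U //; try side; exact: m.
Qed.

Section SplitMix.

Variables (S T D U : sequent) (s : split_rule) (d : option proof) (p q : proof).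
Hypothesis eU : U = D `|` (split_principal s `|` (S `|` T)).
Hypotheses (ok : split_ok s) (m : mixable d) (sD : apart (split_principal s) D)
  (sS : apart (split_principal s) S) (sT : apart (split_principal s) T)
  (DS : apart D S) (DT : apart D T) (ST : apart S T) (hd : derives_opt D d).
Hypotheses (hp : derives (split_active false s `|` S) p)
  (hq : derives (split_active true s `|` T) q).

Lemma equiv_split_mix_optl :
  equiv U (PSplit s (mix_opt d p) q) (mix_opt d (PSplit s p q)).
Proof.
case: d m hd => [r /= mx hr|_ eD]; last first.
  by rewrite eU eD fset0U; apply: equiv_refl; apply: derives_split; side.
have {}mx := mx isT.
(* The residue [r] is made the second premise of the mix, carried past [s] in that position, and
   then put first again. *)
apply: (@equiv_trans _ _ _ _ _ (PSplit s (PSplit RMix p r) q)).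
  rewrite eU; apply: (@equiv_split _ _ _ (D `|` S) T) => //; try side.
    by apply: (@equiv_mixC D (split_active false s `|` S)) => //; side.
  exact: equiv_refl.
apply: (@equiv_trans _ _ _ _ _ (PSplit RMix (PSplit s p q) r)).
  by rewrite eU; apply: (@equiv_split_split_LL _ _ _ S D T) => //=;
    rewrite ?fset0U //; side.
apply: (@equiv_mixC (split_principal s `|` (S `|` T)) D) => //; try side.
- by rewrite eU; side.
- by apply: derives_split => //; side.
Qed.

Lemma equiv_split_mix_optr :
  equiv U (PSplit s p (mix_opt d q)) (mix_opt d (PSplit s p q)).
Proof.
case: d m hd => [r /= mx hr|_ eD]; last first.
  by rewrite eU eD fset0U; apply: equiv_refl; apply: derives_split; side.
have {}mx := mx isT.
by rewrite eU; apply: (@equiv_split_split_RR _ _ _ S D T) => //=;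
  rewrite ?fset0U //; side.
Qed.

End SplitMix.

Lemma equiv_split_mix_opts S T D E U s d e p q :
  U = D `|` E `|` (split_principal s `|` (S `|` T)) ->
  split_ok s -> mixable d -> mixable e ->
  apart (split_principal s) D -> apart (split_principal s) E ->
  apart (split_principal s) S -> apart (split_principal s) T ->
  apart D E -> apart D S -> apart D T -> apart E S -> apart E T -> apart S T ->
  derives_opt D d -> derives_opt E e ->
  derives (split_active false s `|` S) p -> derives (split_active true s `|` T) q ->
  equiv U (PSplit s (mix_opt d p) (mix_opt e q))
    (mix_opt (mix_opts d e) (PSplit s p q)).
Proof.
move=> -> ok md me sD sE sS sT DE DS DT ES ET ST hd he hp hq.
apply: (@equiv_trans _ _ _ _ _ (mix_opt d (PSplit s p (mix_opt e q)))).
  apply: (@equiv_split_mix_optl S (E `|` T) D) => //; try side.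
  by apply: (@derives_mix_opt E (split_active true s `|` T)) => //; side.
apply: (@equiv_trans _ _ _ _ _ (mix_opt d (mix_opt e (PSplit s p q)))).
  apply: (@equiv_mix_opt D (E `|` (split_principal s `|` (S `|` T)))) => //;
    try side.
  by apply: (@equiv_split_mix_optr S T E) => //; side.
apply: (@equiv_mix_optA D E (split_principal s `|` (S `|` T))) => //; try side.
by apply: derives_split => //; side.
Qed.

End OptionalMix.

(** * Colourings *)

Definition within (P : pred vertex) (l : linking) : linking :=
  [fset k in l | all P (k : link)].

Lemma in_within P l k : (k \in within P l) = (k \in l) && all P k.
Proof. exact: in_fset_sep. Qed.

Lemma withinU P l m : within P (l `|` m) = within P l `|` within P m.
Proof. by apply/fsetP => k; rewrite !(in_within, in_fsetU) andb_orl. Qed.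

Lemma withinC P Q l : within P (within Q l) = within Q (within P l).
Proof. by apply/fsetP => k; rewrite !in_within andbAC. Qed.

(** A linking of a split determines its two summands: a nonempty link cannot lie under both of two
    incomparable sequents. *)
Lemma within_covers S T l m : covers S l -> covers T m -> apart S T ->
  within (under S) (l `|` m) = l.
Proof.
move=> hl hm ap; apply/fsetP => k; rewrite in_within in_fsetU.
apply/andP/idP => [[/orP[//|km] /allP a]|kl]; last first.
  by rewrite kl; split=> //; apply/allP => v /(hl _ kl).2.
have [/fset0Pn[v vk] /(_ v vk)/underP[u uT uv]] := hm _ km.
have /underP[w wS wv] := a v vk.
by have := ap _ _ wS uT; rewrite (below_cmp wv uv).
Qed.

Section Colours.

Variable c : vertex -> bool.

Definition part (b : bool) (S : sequent) : sequent := [fset v in S | c v == b].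

Definition links (b : bool) (l : linking) : linking :=
  within (fun v => c v == b) l.

(** The colour is constant on each tree of the sequent, so that a logical rule acts inside a single
    colour. *)
Definition monochrome (S : sequent) : Prop :=
  forall u v, u \in S -> below u v -> c v = c u.

Definition coloured (b : bool) (S : sequent) : Prop :=
  forall v, v \in S -> c v = b.

Definition separated (L : {fset linking}) : Prop :=
  (forall l k, l \in L -> k \in l -> exists b, forall v, v \in k -> c v = b) /\
  (forall b l m, l \in L -> m \in L -> links b l `|` links (~~ b) m \in L).

Lemma in_part b S v : (v \in part b S) = (v \in S) && (c v == b).
Proof. exact: in_fset_sep. Qed.

Lemma partU b S T : part b (S `|` T) = part b S `|` part b T.
Proof. by apply/fsetP => v; rewrite !(in_part, in_fsetU) andb_orl. Qed.

Lemma part_sub b S : part b S `<=` S.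
Proof. by apply/fsubsetP => v; rewrite in_part => /andP[]. Qed.

Lemma part_coloured b S : coloured b S -> part b S = S.
Proof.
by move=> h; apply/fsetP => v; rewrite in_part andb_idr // => /h ->.
Qed.

Lemma part_coloured0 b S : coloured b S -> part (~~ b) S = fset0.
Proof.
move=> h; apply/fsetP => v; rewrite in_part in_fset0.
by apply/negP => /andP[/h ->]; case: b {h}.
Qed.

Lemma partK b S : S = part b S `|` part (~~ b) S.
Proof.
apply/fsetP => v; rewrite in_fsetU !in_part -andb_orr.
by case: (c v); case: b; rewrite ?andbT.
Qed.

Lemma apart_part b S T : apart S T -> apart (part b S) T.
Proof. by move=> h; apply: apart_sub h (part_sub b S) (fsubset_refl T). Qed.

Lemma apart_parts b S : monochrome S -> apart (part b S) (part (~~ b) S).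
Proof.
move=> h u v; rewrite !in_part => /andP[uS /eqP cu] /andP[vS /eqP cv].
apply/negP => /orP[/(h _ _ uS)|/(h _ _ vS)]; rewrite cu cv; by case: b {cu cv}.
Qed.

Lemma monochrome_sub S T : S `<=` T -> monochrome T -> monochrome S.
Proof. by move=> /fsubsetP sT h u v /sT; apply: h. Qed.

Lemma under_coloured b S v : monochrome S -> coloured b S -> under S v -> c v = b.
Proof. by move=> mS cS /underP[u uS uv]; rewrite (mS u v uS uv) cS. Qed.

Lemma coloured_part b S : coloured b (part b S).
Proof. by move=> v; rewrite in_part => /andP[_ /eqP]. Qed.

Lemma colouredU b S T : coloured b S -> coloured b T -> coloured b (S `|` T).
Proof. by move=> hS hT v; rewrite in_fsetU => /orP[/hS|/hT]. Qed.

Lemma monochrome_part b S : monochrome S -> monochrome (part b S).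
Proof. exact: monochrome_sub (part_sub b S). Qed.

Lemma monochromeU S T : monochrome S -> monochrome T -> monochrome (S `|` T).
Proof. by move=> hS hT u v; rewrite in_fsetU => /orP[/hS|/hT]; apply. Qed.

Lemma monochrome_children x A S :
  children x A -> monochrome ([fset x] `|` S) -> monochrome (A `|` S).
Proof.
move=> hA h; apply: monochromeU; last by apply: monochrome_sub h; rewrite fsubsetUr.
move=> u v uA uv; have xu := children_below hA uA.
by rewrite (h x u) ?(h x v) ?(below_trans xu uv) // !inE eqxx.
Qed.

Lemma coloured_children x A S :
  children x A -> monochrome ([fset x] `|` S) -> coloured (c x) A.
Proof.
by move=> hA h v /(children_below hA); apply: h; rewrite !inE eqxx.
Qed.

Lemma linksU b l m : links b (l `|` m) = links b l `|` links b m.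
Proof. exact: withinU. Qed.

Lemma links_idem b l : links b (links b l) = links b l.
Proof. by apply/fsetP => k; rewrite !in_within -andbA andbb. Qed.

Lemma links_opp S b l : covers S l -> links (~~ b) (links b l) = fset0.
Proof.
move=> h; apply/fsetP => k; rewrite !in_within in_fset0.
apply/negP => /andP[/andP[/h[/fset0Pn[v vk] _] /allP/(_ v vk)/eqP cb]].
by move=> /allP/(_ v vk); rewrite cb; case: b {cb}.
Qed.

Lemma links_coloured S b l :
  covers S l -> (forall v, under S v -> c v = b) -> links b l = l.
Proof.
move=> h cS; apply/fsetP => k; rewrite in_within andb_idr // => /h[_ hk].
by apply/allP => v /hk /cS ->.
Qed.

Lemma links_coloured0 S b l :
  covers S l -> (forall v, under S v -> c v = b) -> links (~~ b) l = fset0.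
Proof.
by move=> h cS; rewrite -(links_opp b h) (links_coloured h cS).
Qed.

(** All leaves below [y] have colour [b], and a link reaching one of them is entirely of colour [b];
    so only the summand of that colour decides whether [y] is reached. *)
Lemma touches_recombine y b (l m : linking) :
  (forall k, k \in l -> exists b, forall v, v \in k -> c v = b) ->
  (forall v, below y v -> c v = b) ->
  touches y (links b l `|` links (~~ b) m) = touches y l.
Proof.
move=> hl hy; apply/touchesP/touchesP => -[k [v [kl vk yv]]]; exists k, v.
  split=> //; move: kl; rewrite in_fsetU !in_within => /orP[/andP[]//|].
  by case/andP=> _ /allP/(_ v vk); rewrite (hy v yv); case: b {hy}.
split=> //; rewrite in_fsetU in_within kl /=; apply/orP; left.
have [b' hk] := hl k kl; apply/allP => w wk.
by rewrite (hk w wk) -(hk v vk) (hy v yv).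
Qed.

Section Separation.

Variables (V : Type) (mix : bool) (G : seq (form V)).

Notation derives := (derives mix G).

(** Linkings of one premise are padded with a fixed linking of the other, recombined in the
    conclusion, and projected back by keeping the links under the premise. The projection commutes
    with selecting a colour ([withinC]). *)
Lemma separated_split S s p q : antichain S -> derives S (PSplit s p q) ->
  separated (translation (PSplit s p q)) ->
  separated (translation p) /\ separated (translation q).
Proof.
move=> aS d [h1 h2].
have [T [U [_ _ sTU TU [_ _ dp dq]]]] := derives_splitP aS d.
have [sT sU] := (apartUr _ _ _).1 sTU.
have ap : apart (split_active false s `|` T) (split_active true s `|` U).
  apply/apartUl; split; apply/apartUr; split=> //.
  - exact: apart_split_active.
  - exact: apart_split.
  - by apply/apartC; apply: apart_split.
have [l0 hl0] := translation_neq0 p; have [m0 hm0] := translation_neq0 q.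
split; split.
- by move=> l k lp kl; apply: (h1 (l `|` m0));
    rewrite ?in_translation_split // in_fsetU kl.
- move=> b l l' hl hl'.
  have /(h2 b _ _ (in_translation_split s hl hm0)) :=
    in_translation_split s hl' hm0.
  case/translation_splitP=> l1 l1p [m1 m1q] /(congr1 (within (under
    (split_active false s `|` T)))).
  have cp l := @derives_covers _ _ _ _ _ l dp.
  have cq l := @derives_covers _ _ _ _ _ l dq.
  rewrite (within_covers (cp _ l1p) (cq _ m1q) ap) withinU /links.
  rewrite ![within (under _) (within _ _)]withinC.
  by rewrite !(within_covers (cp _ _) (cq _ hm0) ap) // => ->.
- by move=> m k mq km; apply: (h1 (l0 `|` m));
    rewrite ?in_translation_split // in_fsetU km orbT.
- move=> b m m' hm hm'.
  have /(h2 b _ _ (in_translation_split s hl0 hm)) :=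
    in_translation_split s hl0 hm'.
  case/translation_splitP=> l1 l1p [m1 m1q] /(congr1 (within (under
    (split_active true s `|` U)))).
  have cp l := @derives_covers _ _ _ _ _ l dp.
  have cq l := @derives_covers _ _ _ _ _ l dq.
  rewrite [l1 `|` m1]fsetUC ![l0 `|` _]fsetUC.
  rewrite (within_covers (cq _ m1q) (cp _ l1p) (apartC ap)) withinU /links.
  rewrite ![within (under _) (within _ _)]withinC.
  by rewrite !(within_covers (cq _ _) (cp _ hl0) (apartC ap)) // => ->.
Qed.

(** Whichever colour is taken from which linking, the part below [y] comes wholly from [l] or wholly
    from [m], and both reach [y]. *)
Lemma touches_mix (L : {fset linking}) y b b' l m :
  separated L -> (forall v, below y v -> c v = b) -> l \in L -> m \in L ->
  touches y l -> touches y m -> touches y (links b' l `|` links (~~ b') m).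
Proof.
move=> [h _] hy hl hm tl tm; case: (eqVneq b' b) => [->|].
  by rewrite (touches_recombine _ _ hy) // => k; apply: h.
move=> nb; have -> : b' = ~~ b by case: b b' nb {hy} => [] [].
rewrite negbK fsetUC (touches_recombine _ _ hy) // => k; exact: h.
Qed.

(** The linkings of a premise are those that reach the corresponding child of [x], and by
    [touches_mix] recombination stays among them. *)
Lemma separated_with S x p q : antichain S -> monochrome [fset x] ->
  derives S (PWith x p q) -> separated (translation (PWith x p q)) ->
  separated (translation p) /\ separated (translation q).
Proof.
move=> aS mx d sep; have := with_translationl aS d.
have := with_translationr aS d.
have hc b v : below (child b x) v -> c v = c x.
  move=> h; apply: (mx x); first by rewrite inE.
  exact: below_trans (below_child b x) h.
move: (translation _) sep => L sep -> ->.
have H b : separated [fset l in L | touches (child b x) l].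
  split=> [l k|b' l m]; rewrite !in_fset_sep => /andP[hl tl].
    by move: hl; case: sep => h _; apply: h.
  move=> /andP[hm tm]; rewrite (touches_mix _ sep (hc b)) // andbT.
  by case: sep => _; apply.
by split.
Qed.

(** The choice made at [x] depends only on links of the colour of [x]. Exchanging these for the ones
    of a linking of the other premise therefore carries [l] into that premise without changing its
    links of the opposite colour. *)
Lemma with_links S x p q l : antichain S -> monochrome [fset x] ->
  derives S (PWith x p q) -> separated (translation (PWith x p q)) ->
  (l \in translation p -> exists2 m, m \in translation q &
    links (~~ c x) m = links (~~ c x) l) /\
  (l \in translation q -> exists2 m, m \in translation p &
    links (~~ c x) m = links (~~ c x) l).
Proof.
move=> aS mx d sep; have ep := with_translationl aS d.
have eq := with_translationr aS d.
have cov m (hm : m \in translation (PWith x p q)) := derives_covers d hm.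
have hc b v : below (child b x) v -> c v = c x.
  move=> h; apply: (mx x); first by rewrite inE.
  exact: below_trans (below_child b x) h.
have [m1 hm1] := translation_neq0 p; have [m2 hm2] := translation_neq0 q.
move: hm1 hm2 cov ep eq; move: (translation (PWith x p q)) sep => L sep.
move=> hm1 hm2 cov e1 e2; move: hm1 hm2; rewrite e1 e2 !in_fset_sep.
case/andP=> hm1 tm1 /andP[hm2 tm2]; case: (sep) => sep1 sep2.
have mono m (hm : m \in L) k := sep1 m k hm.
have e m : m \in L -> links (~~ c x) (links (c x) m) = fset0.
  by move=> /cov; apply: links_opp.
split=> /andP[hl tl].
  (* [m2] contributes the colour of [x], and with it the right argument; [l] contributes the colour
     to be preserved. *)
  exists (links (c x) m2 `|` links (~~ c x) l).
    rewrite in_fset_sep sep2 //= (touches_recombine _ _ (hc true)) //.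
    exact: mono.
  by rewrite linksU links_idem e // fset0U.
exists (links (c x) m1 `|` links (~~ c x) l).
  rewrite in_fset_sep sep2 //= (touches_recombine _ _ (hc false)) //.
  exact: mono.
by rewrite linksU links_idem e // fset0U.
Qed.

(** Premises of opposite colours are recovered from the unions by selecting a colour; this lets
    equal translations of two splits descend to their premises. *)
Lemma separated_links S T b s p q :
  derives S p -> derives T q ->
  (forall v, under S v -> c v = b) -> (forall v, under T v -> c v = ~~ b) ->
  translation p = [fset links b l | l in translation (PSplit s p q)] /\
  translation q = [fset links (~~ b) l | l in translation (PSplit s p q)].
Proof.
move=> dp dq hS hT; have [l0 hl0] := translation_neq0 p.
have [m0 hm0] := translation_neq0 q.
have E l m : l \in translation p -> m \in translation q ->
    links b (l `|` m) = l /\ links (~~ b) (l `|` m) = m.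
  move=> /(derives_covers dp) hl /(derives_covers dq) hm.
  rewrite !linksU (links_coloured hl hS) (links_coloured0 hl hS).
  have := links_coloured0 hm hT; rewrite negbK => ->.
  by rewrite (links_coloured hm hT) fset0U fsetU0.
split; apply/fsetP => l; apply/idP/imfsetP => [hl|[l' /= hl' ->]].
- by exists (l `|` m0); [exact: in_translation_split | case: (E l m0)].
- by case/translation_splitP: hl' => l1 h1 [l2 h2 ->]; case: (E l1 l2 h1 h2) => ->.
- by exists (l0 `|` l); [exact: in_translation_split | case: (E l0 l)].
- by case/translation_splitP: hl' => l1 h1 [l2 h2 ->]; case: (E l1 l2 h1 h2) => _ ->.
Qed.

(** When the two summands have opposite colours, recombining two unions merely pairs a summand of
    one with the complementary summand of the other. *)
Lemma split_separated S T b s p q :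
  derives S p -> derives T q ->
  (forall v, under S v -> c v = b) -> (forall v, under T v -> c v = ~~ b) ->
  separated (translation (PSplit s p q)).
Proof.
move=> dp dq hS hT.
have E l m : l \in translation p -> m \in translation q ->
    links b (l `|` m) = l /\ links (~~ b) (l `|` m) = m.
  move=> /(derives_covers dp) hl /(derives_covers dq) hm.
  rewrite !linksU (links_coloured hl hS) (links_coloured0 hl hS).
  have := links_coloured0 hm hT; rewrite negbK => ->.
  by rewrite (links_coloured hm hT) fset0U fsetU0.
split=> [l k /translation_splitP[m hm [n hn ->]]|b' l m].
  rewrite in_fsetU => /orP[km|kn].
    by exists b => v vk; apply: hS; apply: (derives_covers dp hm km).2.
  by exists (~~ b) => v vk; apply: hT; apply: (derives_covers dq hn kn).2.
case/translation_splitP=> l1 h1 [l2 h2 ->].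
case/translation_splitP=> m1 k1 [m2 k2 ->].
have [e1 e2] := E _ _ h1 h2; have [e3 e4] := E _ _ k1 k2.
apply/translation_splitP; case: (eqVneq b' b) => [->|nb].
  by rewrite e1 e4; exists l1 => //; exists m2.
have -> : b' = ~~ b by case: b b' nb {hS hT E e1 e2 e3 e4} => [] [].
by rewrite negbK e2 e3; exists m1 => //; exists l2; rewrite // fsetUC.
Qed.

End Separation.
End Colours.

(** * Sizes of sequents *)

Section Size.

Variables (V : Type) (mix : bool) (G : seq (form V)).

Fixpoint form_size (A : form V) : nat :=
  match A with
  | Var _ | NVar _ => 1
  | Tens B C | Parr B C | Amp B C | Oplus B C => (form_size B + form_size C).+1
  end.

(** The default outside the forest is 1 rather than 0, so that every vertex has positive size. *)
Definition vertex_size (v : vertex) : nat :=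
  if subform G v is Some A then form_size A else 1.

Definition sequent_size (S : sequent) : nat := \sum_(v <- S) vertex_size v.

Lemma vertex_size_gt0 v : 0 < vertex_size v.
Proof. by rewrite /vertex_size; case: subform => // -[]. Qed.

Lemma subform_child b x :
  subform G (child b x) = obind (fun A => subform_path A [:: b]) (subform G x).
Proof.
rewrite /subform /=; case: (onth G x.1) => //= A.
elim: x.2 A => [|b' w IH] A; first by case: A.
by case: A => [v|v|B C|B C|B C|B C] //=; rewrite IH.
Qed.

(** The bound is on the sum because the premise of a par contains both children. *)
Lemma vertex_size_children x B C (A := subform G x) :
  A = Some (Tens B C) \/ A = Some (Parr B C) \/ A = Some (Amp B C) \/
    A = Some (Oplus B C) ->
  vertex_size (child false x) + vertex_size (child true x) < vertex_size x.
Proof.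
rewrite /A /vertex_size => h; rewrite !subform_child.
have sub0 (D : form V) : subform_path D [::] = Some D by case: D.
by move: h => [|[|[|]]] -> /=; rewrite !sub0 ltnSn.
Qed.

Lemma sequent_size1 x : sequent_size [fset x] = vertex_size x.
Proof. exact: big_seq_fset1. Qed.

Lemma sequent_sizeU S T : [disjoint S & T] ->
  sequent_size (S `|` T) = (sequent_size S + sequent_size T)%N.
Proof.
move=> /fdisjointP d; rewrite /sequent_size -big_cat; apply: perm_big.
apply: uniq_perm; rewrite ?fset_uniq //.
  rewrite cat_uniq !fset_uniq /= andbT; apply/hasPn => v vT.
  by apply/negP => /d; rewrite vT.
by move=> v; rewrite mem_cat in_fsetU.
Qed.

Lemma sequent_size_sub S T : S `<=` T -> sequent_size S <= sequent_size T.
Proof.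
move=> /fsubsetP sT; have -> : T = S `|` (T `\` S).
  apply/fsetP => v; rewrite in_fsetU in_fsetD; case: (boolP (v \in S)) => //=.
  exact: sT.
rewrite sequent_sizeU ?leq_addr //.
by apply/fdisjointP => v vS; rewrite in_fsetD vS.
Qed.

Lemma sequent_size_gt0 S : S != fset0 -> 0 < sequent_size S.
Proof.
case/fset0Pn=> v vS; apply: leq_trans (vertex_size_gt0 v) _.
by rewrite -sequent_size1; apply: sequent_size_sub; rewrite fsub1set.
Qed.

Lemma sequent_size_un u S : un_ok G u -> apart [fset un_principal u] S ->
  sequent_size (un_active u `|` S) < sequent_size ([fset un_principal u] `|` S).
Proof.
move=> ok h; rewrite !sequent_sizeU; try exact: apart_disjoint.
  rewrite ltn_add2r sequent_size1; case: u ok {h} => [x|b x] [A [B e]] /=.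
    rewrite sequent_sizeU ?sequent_size1; first by apply: vertex_size_children; eauto.
    by rewrite fdisjointX1 inE; apply/negP => /eqP /child_inj[].
  rewrite sequent_size1; have k := @vertex_size_children x A B.
  apply: leq_ltn_trans (k _); last by eauto.
  by case: b; rewrite ?leq_addl ?leq_addr.
by apply: apart_disjoint; apply: apart_un.
Qed.

Lemma sequent_size_with b x S : with_ok G x -> apart [fset x] S ->
  sequent_size ([fset child b x] `|` S) < sequent_size ([fset x] `|` S).
Proof.
move=> [A [B e]] h; rewrite !sequent_sizeU; try exact: apart_disjoint.
  rewrite ltn_add2r !sequent_size1; have k := @vertex_size_children x A B.
  apply: leq_ltn_trans (k _); last by eauto.
  by case: b; rewrite ?leq_addl ?leq_addr.
by apply: apart_disjoint; apply: apart_child.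
Qed.

(** For a tensor the decrease comes from the principal formula, for a mix from the other premise,
    which is nonempty. *)
Lemma sequent_size_split s S T : split_ok mix G s ->
  apart (split_principal s) (S `|` T) -> apart S T ->
  split_active false s `|` S != fset0 -> split_active true s `|` T != fset0 ->
  sequent_size (split_active false s `|` S)
    < sequent_size (split_principal s `|` (S `|` T)) /\
  sequent_size (split_active true s `|` T)
    < sequent_size (split_principal s `|` (S `|` T)).
Proof.
move=> ok sST ST hS hT; have [sS sT] := (apartUr _ _ _).1 sST.
case: s ok sST sS sT hS hT => [x|] /=; last first.
  move=> _ _ _ _; rewrite !fset0U => /sequent_size_gt0 hS /sequent_size_gt0 hT.
  rewrite sequent_sizeU ?apart_disjoint //.
  by rewrite -[X in X < _ /\ _]addn0 ltn_add2l -[X in _ /\ X < _]add0n ltn_add2r.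
move=> [A [B e]] sST sS sT _ _.
have k : vertex_size (child false x) + vertex_size (child true x) < vertex_size x.
  by apply: (@vertex_size_children x A B); eauto.
rewrite !sequent_sizeU; try exact: apart_disjoint;
  try by apply: apart_disjoint; apply: apart_child.
rewrite !sequent_size1; split.
  rewrite addnA -[X in X < _]addn0 -addSn leq_add // ltn_add2r.
  by apply: leq_ltn_trans k; rewrite leq_addr.
rewrite -addSn leq_add ?leq_addl //.
by apply: leq_ltn_trans k; rewrite leq_addl.
Qed.

End Size.

Lemma sub_locate z (S : sequent) : z \in S ->
  exists T, [/\ S = [fset z] `|` T, z \notin T & T `<=` S].
Proof.
move=> zS; exists (S `\ z); split; first by rewrite fsetD1K.
  by rewrite !inE eqxx.
exact: fsubD1set.
Qed.

Lemma fset1U_inj z (S T : sequent) :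
  z \notin S -> z \notin T -> [fset z] `|` S = [fset z] `|` T -> S = T.
Proof. by move=> hS hT e; rewrite -(fsetU1K hS) -(fsetU1K hT) e. Qed.

(** * Moving a unary rule or a & rule to the bottom *)

Section Inversion.

Variables (V : Type) (mix : bool) (G : seq (form V)).

Notation derives := (derives mix G).
Notation split_ok := (split_ok mix G).
Notation un_ok := (un_ok G).
Notation with_ok := (with_ok G).
Notation equiv := (equiv mix G).

Lemma apart_notin1 z S : apart [fset z] S -> z \notin S.
Proof. exact: apart_notin (cmp_refl z). Qed.

(** A formula [z] to be brought to the bottom that is not principal in the last rule lies in its
    context; [R] is what remains of the sequent beside these two formulas. *)
Lemma locate_un z u S T :
  apart [fset z] S -> apart [fset un_principal u] T ->
  [fset z] `|` S = [fset un_principal u] `|` T -> un_principal u != z ->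
  exists R, [/\ S = [fset un_principal u] `|` R, T = [fset z] `|` R,
    apart [fset un_principal u] R, apart [fset un_principal u] [fset z] &
    apart [fset z] R].
Proof.
move=> zS uT e ne; have zT : z \in T.
  have : z \in [fset z] `|` S by rewrite !inE eqxx.
  by rewrite e !inE eq_sym (negPf ne).
have [R [eT zR _]] := sub_locate zT; move: uT; rewrite eT => /apartUr[uz uR].
have eS : S = [fset un_principal u] `|` R.
  apply: (@fset1U_inj z); first exact: apart_notin1.
    by rewrite !inE negb_or eq_sym ne.
  by rewrite e eT fsetUCA.
by exists R; split=> //; move: zS; rewrite eS => /apartUr[].
Qed.

(** For a splitting rule the context is shared out, so [z] goes to one premise only, and the rule
    for [z] has to be brought down in that premise alone. *)
Lemma locate_split z s S T U :
  apart [fset z] S -> apart (split_principal s) (T `|` U) -> apart T U ->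
  [fset z] `|` S = split_principal s `|` (T `|` U) -> z \notin split_principal s ->
  (exists R, [/\ T = [fset z] `|` R, S = split_principal s `|` (R `|` U) &
    [/\ apart [fset z] R, apart [fset z] U, apart [fset z] (split_principal s),
    apart R U & apart (split_principal s) R /\ apart (split_principal s) U]]) \/
  (exists R, [/\ U = [fset z] `|` R, S = split_principal s `|` (T `|` R) &
    [/\ apart [fset z] R, apart [fset z] T, apart [fset z] (split_principal s),
    apart T R & apart (split_principal s) T /\ apart (split_principal s) R]]).
Proof.
move=> zS sTU TU e ns; have [sT sU] := (apartUr _ _ _).1 sTU.
have : z \in [fset z] `|` S by rewrite !inE eqxx.
rewrite e in_fsetU (negPf ns) /= in_fsetU => /orP[] /sub_locate[R [eR zR _]].
  left; exists R; move: sT TU; rewrite eR => /apartUr[sz sR] /apartUl[zU RU].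
  have eS : S = split_principal s `|` (R `|` U).
    apply: (@fset1U_inj z); first exact: apart_notin1.
      by rewrite !in_fsetU !negb_or ns zR apart_notin1.
    by rewrite e eR; fset_ac.
  move: zS; rewrite eS => /apartUr[zs /apartUr[zR' _]].
  by [].
right; exists R; move: sU TU; rewrite eR => /apartUr[sz sR] /apartUr[Tz TR].
have eS : S = split_principal s `|` (T `|` R).
  apply: (@fset1U_inj z); first exact: apart_notin1.
    by rewrite !in_fsetU !negb_or ns zR (apart_notin1 (apartC Tz)).
  by rewrite e eR; fset_ac.
move: zS; rewrite eS => /apartUr[zs /apartUr[zT zR']].
by [].
Qed.

Lemma locate_with z x S T :
  apart [fset z] S -> apart [fset x] T ->
  [fset z] `|` S = [fset x] `|` T -> x != z ->
  exists R, [/\ S = [fset x] `|` R, T = [fset z] `|` R,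
    apart [fset x] R, apart [fset x] [fset z] & apart [fset z] R].
Proof. exact: (@locate_un z (RPar x)). Qed.

Ltac side := lazymatch goal with
  | |- apart _ _ => by apart_tac
  | |- Defs.derives _ _ _ ?p =>
      first [assumption | match goal with h : Defs.derives _ _ _ p |- _ =>
        by apply: (derives_eq h); fset_ac end]
  | e : ?S = ?T |- ?S = ?T => exact: e
  | |- _ = _ => by fset_ac
  | |- _ => assumption
  end.

(** The choice of an argument is expressed by avoidance of the other one: avoidance passes from a
    union of linkings to both summands, whereas reaching the chosen child would hold for only one of
    them. *)
Definition agrees (u : unary_rule) (L : {fset linking}) : Prop :=
  if u is RPlus b x then forall l, l \in L -> ~~ touches (child (~~ b) x) l
  else True.

Lemma un_at_bottom u S p : un_ok u -> agrees u (translation p) ->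
  antichain ([fset un_principal u] `|` S) -> apart [fset un_principal u] S ->
  derives ([fset un_principal u] `|` S) p ->
  exists2 q, derives (un_active u `|` S) q &
    equiv ([fset un_principal u] `|` S) p (PUn u q).
Proof.
move=> ok; elim: p S => [x y|v p IH|s p IHp q IHq|x p IHp q IHq] S ag aS uS d.
- have [e [P [ex ey]]] := derives_axP d.
  have : un_principal u \in [fset x; y] by rewrite -e !inE eqxx.
  by rewrite !inE => /orP[]/eqP eu; move: ok; case: u eu {ag aS uS d e} => [z|b z] /= ->
     [A [B]]; rewrite ?ex ?ey.
- have [T [e okv vT av dp]] := derives_unP aS d.
  have [evu|ne] := eqVneq (un_principal v) (un_principal u).
    have eST : S = T.
      apply: (@fset1U_inj (un_principal u)); first exact: apart_notin1.
        by rewrite -evu; apply: apart_notin1.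
      by rewrite e evu.
    (* At a given vertex the connective fixes the rule up to the side of a plus. The side is fixed
       by [agrees], because every linking reaches the child kept by [v]. *)
    suff evu' : v = u.
      rewrite evu' -eST in dp; rewrite evu'; exists p => //.
      by apply: equiv_refl; apply: derives_un.
    case: u v ok okv ag evu {uS aS d e vT av IH eST} dp => [x|b x] [y|c y] //=
      [A [B e1]] [C [D e2]] ag e; move: e1 e2; rewrite e; try by move=> -> .
    move=> _ _ dp; congr RPlus; have [l hl] := translation_neq0 p.
    have := ag l; rewrite translation_un => /(_ hl).
    have h : touches (child c x) l.
      by apply: (derives_touches dp hl); rewrite in_fsetU /= in_fset1 eqxx.
    by move: h; case: b c {ag dp hl} => [] [] //= ->.
  have [R [eS eT vR vu uR]] := locate_un uS vT e ne.
  have eR : un_active v `|` T = [fset un_principal u] `|` (un_active v `|` R).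
    by rewrite eT fsetUCA.
  rewrite eR in av dp; rewrite translation_un in ag.
  have [||q dq epq] := IH (un_active v `|` R) ag av; [by apart_tac|by []|].
  exists (PUn v q).
    by rewrite eS; apply: (@derives_unE _ _ _ (un_active u `|` R)); side.
  rewrite eS; apply: (@equiv_trans _ _ _ _ _ (PUn v (PUn u q))).
    apply: (@equiv_un _ _ _ ([fset un_principal u] `|` R)); try side.
    by apply: equiv_eq epq _; fset_ac.
  by apply: (@equiv_un_un _ _ _ _ R); side.
- have [T [U [e oks sTU TU [aT aU dp dq]]]] := derives_splitP aS d.
  have ns : un_principal u \notin split_principal s.
    case: s oks {d e sTU aT aU dp dq ag} => //= x [A [B ex]].
    rewrite inE; apply/eqP => eu; move: ok.
    by case: u eu {IHp IHq aS uS} => [z|b z] /= -> [C [D]]; rewrite ex.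
  (* A linking of one premise is completed by an arbitrary linking of the other, and what the union
     avoids each summand avoids. *)
  have [agp agq] : agrees u (translation p) /\ agrees u (translation q).
    have [l0 hl0] := translation_neq0 p; have [m0 hm0] := translation_neq0 q.
    case: u ag {IHp IHq ok aS uS d e ns} => //= b z ag; split=> l hl.
      have := ag _ (in_translation_split s hl hm0).
      by rewrite touchesU negb_or => /andP[].
    have := ag _ (in_translation_split s hl0 hl).
    by rewrite touchesU negb_or => /andP[].
  have [] := locate_split uS sTU TU e ns.
    move=> [R [eT eS [uR uU us RU [sR sU]]]].
    have eR : split_active false s `|` T
        = [fset un_principal u] `|` (split_active false s `|` R).
      by rewrite eT fsetUCA.
    rewrite eR in aT dp.
    have [||p' dp' ep] := IHp (split_active false s `|` R) agp aT;
      [by apart_tac|by []|].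
    exists (PSplit s p' q).
      by rewrite eS; apply: (@derives_splitE _ _ _ (un_active u `|` R) U); side.
    rewrite eS; apply: (@equiv_trans _ _ _ _ _ (PSplit s (PUn u p') q)).
      apply: (@equiv_split _ _ _ ([fset un_principal u] `|` R) U); try side.
        by apply: equiv_eq ep _; fset_ac.
      exact: equiv_refl.
    by apply: (@equiv_split_unl _ _ _ _ R U); side.
  move=> [R [eU eS [uR uT us TR [sT sR]]]].
  have eR : split_active true s `|` U
      = [fset un_principal u] `|` (split_active true s `|` R).
    by rewrite eU fsetUCA.
  rewrite eR in aU dq.
  have [||q' dq' eq] := IHq (split_active true s `|` R) agq aU;
    [by apart_tac|by []|].
  exists (PSplit s p q').
    by rewrite eS; apply: (@derives_splitE _ _ _ T (un_active u `|` R)); side.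
  rewrite eS; apply: (@equiv_trans _ _ _ _ _ (PSplit s p (PUn u q'))).
    apply: (@equiv_split _ _ _ T ([fset un_principal u] `|` R)); try side.
      exact: equiv_refl.
    by apply: equiv_eq eq _; fset_ac.
  by apply: (@equiv_split_unr _ _ _ _ T R); side.
- have [T [e okx xT aT [dp dq]]] := derives_withP aS d.
  have ne : x != un_principal u.
    apply/eqP => eu; move: okx ok => [A [B ex]]; rewrite eu in ex.
    by case: u ex {IHp IHq aS uS d e eu ag} => [z|b z] /= ex [C [D]]; rewrite ex.
  have [R [eS eT xR xu uR]] := locate_with uS xT e ne.
  have [agp agq] : agrees u (translation p) /\ agrees u (translation q).
    case: u ag {IHp IHq ok aS uS d e ne eT xu uR} => //= b z ag.
    by split=> l hl; apply: ag; rewrite translation_with in_fsetU hl ?orbT.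
  have eR b : [fset child b x] `|` T
      = [fset un_principal u] `|` ([fset child b x] `|` R).
    by rewrite eT fsetUCA.
  rewrite eR in dp; rewrite eR in dq.
  have [|||p' dp' ep] := IHp ([fset child false x] `|` R) agp;
    [by rewrite -eR; apply: aT|by apart_tac|by []|].
  have [|||q' dq' eq] := IHq ([fset child true x] `|` R) agq;
    [by rewrite -eR; apply: aT|by apart_tac|by []|].
  exists (PWith x p' q').
    by rewrite eS; apply: (@derives_withE _ _ _ (un_active u `|` R)); side.
  rewrite eS; apply: (@equiv_trans _ _ _ _ _ (PWith x (PUn u p') (PUn u q'))).
    apply: (@equiv_with _ _ _ ([fset un_principal u] `|` R)); try side.
      by apply: equiv_eq ep _; fset_ac.
    by apply: equiv_eq eq _; fset_ac.
  by apply: (@equiv_with_un _ _ _ _ R); side.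
Qed.

Lemma with_at_bottom x S p : with_ok x ->
  antichain ([fset x] `|` S) -> apart [fset x] S -> derives ([fset x] `|` S) p ->
  exists q r, [/\ derives ([fset child false x] `|` S) q,
    derives ([fset child true x] `|` S) r & equiv ([fset x] `|` S) p (PWith x q r)].
Proof.
move=> ok; elim: p S => [y z|v p IH|s p IHp q IHq|y p IHp q IHq] S aS xS d.
- have [e [P [ey ez]]] := derives_axP d; move: ok => [A [B ex]].
  have : x \in [fset y; z] by rewrite -e !inE eqxx.
  by rewrite !inE => /orP[]/eqP ex'; move: ex; rewrite ex' ?ey ?ez.
- have [T [e okv vT av dp]] := derives_unP aS d.
  have ne : un_principal v != x.
    apply/eqP => ev; move: ok okv => [A [B ex]]; rewrite -ev in ex.
    by case: v ex {IH d vT e ev av dp} => [y|b y] /= ex [C [D]]; rewrite ex.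
  have [R [eS eT vR vx xR]] := locate_un xS vT e ne.
  have eR : un_active v `|` T = [fset x] `|` (un_active v `|` R).
    by rewrite eT fsetUCA.
  rewrite eR in av dp.
  have [||q [r [dq dr epq]]] := IH (un_active v `|` R) av; [by apart_tac|by []|].
  exists (PUn v q), (PUn v r); split.
  + by rewrite eS; apply: (@derives_unE _ _ _ ([fset child false x] `|` R)); side.
  + by rewrite eS; apply: (@derives_unE _ _ _ ([fset child true x] `|` R)); side.
  rewrite eS; apply: (@equiv_trans _ _ _ _ _ (PUn v (PWith x q r))).
    apply: (@equiv_un _ _ _ ([fset x] `|` R)); try side.
    by apply: equiv_eq epq _; fset_ac.
  by apply: equiv_sym; apply: (@equiv_with_un _ _ _ _ R); side.
- have [T [U [e oks sTU TU [aT aU dp dq]]]] := derives_splitP aS d.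
  have ns : x \notin split_principal s.
    case: s oks {d e sTU aT aU dp dq} => //= y [A [B ey]].
    rewrite inE; apply/eqP => exy; move: ok => [C [D]].
    by rewrite exy ey.
  have [] := locate_split xS sTU TU e ns.
    move=> [R [eT eS [uR uU us RU [sR sU]]]].
    have eR : split_active false s `|` T = [fset x] `|` (split_active false s `|` R).
      by rewrite eT fsetUCA.
    rewrite eR in aT dp.
    have [||p1 [p2 [dp1 dp2 ep]]] := IHp (split_active false s `|` R) aT;
      [by apart_tac|by []|].
    exists (PSplit s p1 q), (PSplit s p2 q); split.
    + rewrite eS.
      by apply: (@derives_splitE _ _ _ ([fset child false x] `|` R) U); side.
    + rewrite eS.
      by apply: (@derives_splitE _ _ _ ([fset child true x] `|` R) U); side.
    rewrite eS; apply: (@equiv_trans _ _ _ _ _ (PSplit s (PWith x p1 p2) q)).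
      apply: (@equiv_split _ _ _ ([fset x] `|` R) U); try side.
        by apply: equiv_eq ep _; fset_ac.
      exact: equiv_refl.
    by apply: (@equiv_split_withl _ _ _ _ R U); side.
  move=> [R [eU eS [uR uT us TR [sT sR]]]].
  have eR : split_active true s `|` U = [fset x] `|` (split_active true s `|` R).
    by rewrite eU fsetUCA.
  rewrite eR in aU dq.
  have [||q1 [q2 [dq1 dq2 eq]]] := IHq (split_active true s `|` R) aU;
    [by apart_tac|by []|].
  exists (PSplit s p q1), (PSplit s p q2); split.
  + rewrite eS.
    by apply: (@derives_splitE _ _ _ T ([fset child false x] `|` R)); side.
  + rewrite eS.
    by apply: (@derives_splitE _ _ _ T ([fset child true x] `|` R)); side.
  rewrite eS; apply: (@equiv_trans _ _ _ _ _ (PSplit s p (PWith x q1 q2))).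
    apply: (@equiv_split _ _ _ T ([fset x] `|` R)); try side.
      exact: equiv_refl.
    by apply: equiv_eq eq _; fset_ac.
  by apply: (@equiv_split_withr _ _ _ _ T R); side.
- have [T [e oky yT aT [dp dq]]] := derives_withP aS d.
  have [eyx|ne] := eqVneq y x.
    have eST : S = T.
      apply: (@fset1U_inj x); first exact: apart_notin1.
        by rewrite -eyx; apply: apart_notin1.
      by rewrite e eyx.
    by rewrite eyx -eST in dp dq d; exists p, q; split=> //; rewrite eyx; apply: equiv_refl.
  have [R [eS eT yR yx xR]] := locate_with xS yT e ne.
  have eR b : [fset child b y] `|` T = [fset x] `|` ([fset child b y] `|` R).
    by rewrite eT fsetUCA.
  rewrite eR in dp; rewrite eR in dq.
  have [|||p1 [p2 [dp1 dp2 ep]]] := IHp ([fset child false y] `|` R);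
    [by rewrite -eR; apply: aT|by apart_tac|by []|].
  have [|||q1 [q2 [dq1 dq2 eq]]] := IHq ([fset child true y] `|` R);
    [by rewrite -eR; apply: aT|by apart_tac|by []|].
  exists (PWith y p1 q1), (PWith y p2 q2); split.
  + by rewrite eS; apply: (@derives_withE _ _ _ ([fset child false x] `|` R)); side.
  + by rewrite eS; apply: (@derives_withE _ _ _ ([fset child true x] `|` R)); side.
  rewrite eS; apply: (@equiv_trans _ _ _ _ _ (PWith y (PWith x p1 p2) (PWith x q1 q2))).
    apply: (@equiv_with _ _ _ ([fset x] `|` R)); try side.
      by apply: equiv_eq ep _; fset_ac.
    by apply: equiv_eq eq _; fset_ac.
  by apply: (@equiv_with_with _ _ _ _ R); side.
Qed.

End Inversion.

(** * Separating the two colours *)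

Ltac part_ac :=
  let z := fresh "z" in
  rewrite /=; apply/fsetP => z; rewrite ?in_fsetU ?in_part ?in_fset0 ?eqbF_neg ?eqb_id;
  repeat match goal with
    |- context [@in_mem ?T z ?A] => generalize (@in_mem T z A); case end;
  rewrite //= ?negbK;
  match goal with |- context [?c z == ~~ ?b] => by case: (c z); generalize b; case
  | |- context [?c z] => by case: (c z) end.

Ltac part_tac := lazymatch goal with
  | |- apart (_ `|` _) _ => apply/apartUl; split; part_tac
  | |- apart _ (_ `|` _) => apply/apartUr; split; part_tac
  | |- apart (split_active _ ?s) (split_active _ ?s) =>
      first [exact: apart_split_active | apply: apartC; exact: apart_split_active]
  | |- apart fset0 _ => exact: apart0l
  | |- apart _ fset0 => exact: apart0r
  | |- apart (un_active _) _ => apply: apart_un; part_tac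
  | |- apart _ (un_active _) => apply: apartC; apply: apart_un; part_tac
  | |- apart (split_active _ _) _ => apply: apart_split; part_tac
  | |- apart _ (split_active _ _) => apply: apartC; apply: apart_split; part_tac
  | |- apart [fset child _ _] _ => apply: apart_child; part_tac
  | |- apart _ [fset child _ _] => apply: apartC; apply: apart_child; part_tac
  | |- apart (part _ _ ?S) (part _ _ ?S) =>
      first [apply: apart_parts | apply: apartC; apply: apart_parts]; assumption
  | |- apart (part _ _ _) _ => apply: apart_part; part_tac
  | |- apart _ (part _ _ _) => apply: apartC; apply: apart_part; part_tac
  | |- apart ?S ?T => match goal with
      | h : apart S T |- _ => exact: h
      | h : apart T S |- _ => exact: (apartC h)
      | _ => first [assumption | apply: apartC; assumption]
      end
  end.

Section Separations.

Variables (V : Type) (mix : bool) (G : seq (form V)).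

Notation derives := (derives mix G).
Notation split_ok := (split_ok mix G).
Notation un_ok := (un_ok G).
Notation with_ok := (with_ok G).
Notation equiv := (equiv mix G).
Notation derives_opt := (derives_opt mix G).
Notation mixable := (mixable mix).
Notation size := (sequent_size G).

Ltac side := lazymatch goal with
  | |- apart _ _ => by part_tac
  | |- Defs.derives _ _ _ ?p =>
      first [assumption | match goal with h : Defs.derives _ _ _ p |- _ =>
        by apply: (derives_eq h); part_ac end]
  | e : ?S = ?T |- ?S = ?T => exact: e
  | |- _ = _ => by part_ac
  | |- _ => assumption
  end.

(** The hypothesis of the outer induction on size, stated as a predicate so that the separations can
    assume it. *)
Definition complete_below (n : nat) : Prop := forall S p q,
  size S < n -> antichain S -> derives S p -> derives S q ->
  translation p = translation q -> convertible mix G p q.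

Lemma equiv_translation S p q : equiv S p q -> translation p = translation q.
Proof. by case=> _ _ /convertible_translation. Qed.

(** The linkings of [r1] and [r2] are the links of colour opposite to [x] in the linkings of the two
    premises. These agree by [with_links], and the common sequent [T] is small enough for
    [complete_below]. *)
Lemma with_residual n c S T p1 p2 r1 r2 s s' x p q :
  complete_below n -> size T < n -> antichain T -> antichain S ->
  monochrome c [fset x] -> derives S (PWith x p q) ->
  separated c (translation (PWith x p q)) ->
  translation p = translation (PSplit s p1 r1) ->
  translation q = translation (PSplit s' p2 r2) ->
  (exists2 A, derives A p1 & monochrome c A /\ coloured c (c x) A) ->
  (exists2 A, derives A p2 & monochrome c A /\ coloured c (c x) A) ->
  monochrome c T -> coloured c (~~ c x) T -> derives T r1 -> derives T r2 ->
  equiv T r1 r2.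
Proof.
move=> compl nT aT aS mx d sep ep eq [A dp1 [mA cA]] [B dp2 [mB cB]] mT cT dr1 dr2.
have uA v := @under_coloured _ _ _ v mA cA; have uB v := @under_coloured _ _ _ v mB cB.
have uT v := @under_coloured _ _ _ v mT cT.
split=> //; apply: (compl T r1 r2 nT aT dr1 dr2).
have [_ ->] := separated_links s dp1 dr1 uA uT.
have [_ ->] := separated_links s' dp2 dr2 uB uT.
rewrite -ep -eq; apply/fsetP => l.
apply/imfsetP/imfsetP => -[m /= hm ->];
  have [h1 h2] := with_links m aS mx d sep.
  by have [m' h <-] := h1 hm; exists m'.
by have [m' h <-] := h2 hm; exists m'.
Qed.

Definition splits_off c b S p := exists q d,
  [/\ derives (part c b S) q, derives_opt (part c (~~ b) S) d, mixable d &
      equiv S p (mix_opt d q)].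

Lemma splits_off_coloured c b S p :
  coloured c b S -> derives S p -> splits_off c b S p.
Proof.
move=> cS d; exists p, None; split=> //=.
- by rewrite part_coloured.
- by rewrite part_coloured0.
- exact: equiv_refl.
Qed.

(** The part split off needs an actual proof, the other only an optional one. Their roles can be
    exchanged when the new part is nonempty: its optional proof is then present, and the mix is
    turned round. *)
Lemma splits_offC c b b' S p : monochrome c S -> splits_off c b S p ->
  part c b' S != fset0 -> splits_off c b' S p.
Proof.
move=> mS h ne; have [<-//|nb] := eqVneq b b'.
have eb : b = ~~ b' by case: b b' nb {h ne} => [] [].
move: h; rewrite eb => -[q [[r|] [dq dr md e]]]; last first.
  by move: dr ne; rewrite /= negbK => ->; rewrite eqxx.
rewrite negbK in dr; exists r, (Some q); split=> //.
apply: equiv_trans e _; apply: (@equiv_mixC _ _ _ (part c b' S) (part c (~~ b') S)) => //.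
- exact: partK.
- exact: md.
- exact: apart_parts.
Qed.

Lemma splits_off_any c S p : monochrome c S ->
  (exists b, splits_off c b S p) ->
  forall b, part c b S != fset0 -> splits_off c b S p.
Proof. by move=> mS [b' h] b; apply: splits_offC h. Qed.

Lemma monochrome_premise c b s S : monochrome c (split_principal s `|` S) ->
  monochrome c (split_active b s `|` S).
Proof. by case: s => //= x; apply: monochrome_children; apply: children1. Qed.

Lemma coloured_premise c b b' s S :
  monochrome c (split_principal s `|` S) -> coloured c b (split_principal s) ->
  coloured c b (split_active b' s).
Proof.
case: s => [x|] //= mS cx; have <- : c x = b by apply: cx; rewrite inE.
exact: coloured_children (@children1 b' x) mS.
Qed.

(** A tensor imposes the colour of its principal formula, and its active child makes that part
    nonempty. A mix imposes none, so the colour of any vertex of the premise serves. *)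
Lemma premise_colour c b s S : monochrome c (split_principal s `|` S) ->
  split_active b s `|` S != fset0 ->
  exists b', coloured c b' (split_principal s) /\
    part c b' (split_active b s `|` S) != fset0.
Proof.
case: s => [x|] /= mS; last first.
  case/fset0Pn=> v vS; exists (c v); split=> //.
  by apply/fset0Pn; exists v; rewrite in_part vS eqxx.
exists (c x); split=> [v|]; first by rewrite inE => /eqP->.
apply/fset0Pn; exists (child b x); rewrite in_part in_fsetU in_fset1 eqxx.
by rewrite (mS x (child b x)) ?below_child ?eqxx // !inE eqxx.
Qed.

Lemma part_un c S u T : S = [fset un_principal u] `|` T -> monochrome c S ->
  let b := c (un_principal u) in
  [/\ part c b S = [fset un_principal u] `|` part c b T,
      part c (~~ b) S = part c (~~ b) T,
      part c b (un_active u `|` T) = un_active u `|` part c b T &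
      part c (~~ b) (un_active u `|` T) = part c (~~ b) T].
Proof.
move=> -> mS b.
have cu : coloured c b (un_active u) := coloured_children (@children_un u) mS.
have cx : coloured c b [fset un_principal u] by move=> v; rewrite inE => /eqP->.
by split; rewrite !partU ?(part_coloured cx) ?(part_coloured cu)
  ?(part_coloured0 cx) ?(part_coloured0 cu) ?fset0U.
Qed.

Lemma part_with c S x T b' : S = [fset x] `|` T -> monochrome c S ->
  let b := c x in
  [/\ part c b S = [fset x] `|` part c b T,
      part c (~~ b) S = part c (~~ b) T,
      part c b ([fset child b' x] `|` T) = [fset child b' x] `|` part c b T &
      part c (~~ b) ([fset child b' x] `|` T) = part c (~~ b) T].
Proof. exact: (@part_un c S (RPlus b' x) T). Qed.

Lemma part_split c b b' s S : coloured c b (split_active b' s) ->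
  part c b (split_active b' s `|` S) = split_active b' s `|` part c b S /\
  part c (~~ b) (split_active b' s `|` S) = part c (~~ b) S.
Proof.
by move=> cs; rewrite !partU (part_coloured cs) (part_coloured0 cs) fset0U.
Qed.

(** Two residues for the same [S] are both present or both absent, according to whether [S] is
    empty; in the first case [with_residual] applies. *)
Lemma mix_opt_residual n c S T R x p q d e p1 q1 :
  complete_below n -> size S < n -> antichain S -> antichain T ->
  monochrome c [fset x] -> derives T (PWith x p q) ->
  separated c (translation (PWith x p q)) ->
  translation p = translation (mix_opt d p1) ->
  translation q = translation (mix_opt e q1) ->
  (exists2 A, derives A p1 & monochrome c A /\ coloured c (c x) A) ->
  (exists2 A, derives A q1 & monochrome c A /\ coloured c (c x) A) ->
  monochrome c S -> coloured c (~~ c x) S ->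
  derives_opt S d -> derives_opt S e -> mixable e -> apart S R -> derives R q1 ->
  equiv (S `|` R) (mix_opt e q1) (mix_opt d q1).
Proof.
move=> compl nS aS aT mx dw sep ep eq hp hq mS cS dd de me SR dR.
case: d dd ep => [r|] dd ep; case: e me de eq => [r'|] me de eq.
(* [mix_opt] puts the residue first, [with_residual] expects it second. *)
- rewrite /= [RHS]translation_splitC in ep; rewrite /= [RHS]translation_splitC in eq.
  have er := with_residual compl nS aS aT mx dw sep ep eq hp hq mS cS dd de.
  apply: (@equiv_split _ _ _ S R) => //=; rewrite ?fset0U //.
  + exact: me.
  + exact: equiv_sym.
  + exact: equiv_refl.
- by have := derives_neq0 dd; rewrite (de : S = fset0) eqxx.
- by have := derives_neq0 de; rewrite (dd : S = fset0) eqxx.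
- by rewrite (de : S = fset0) fset0U; apply: equiv_refl.
Qed.

Lemma un_active_neq0 u : exists a, a \in un_active u.
Proof.
by case: u => [x|b x]; [exists (child false x)|exists (child b x)];
  rewrite /= !inE eqxx.
Qed.

(** Without mix the conclusion says that [S] has one colour only, since the optional part must be
    empty. The inner induction on [p] keeps the bound [n]; only the residues at a & need to fall
    strictly below it. *)
Lemma mix_separation n c p S : complete_below n -> size S <= n ->
  antichain S -> monochrome c S -> derives S p -> separated c (translation p) ->
  forall b, part c b S != fset0 -> splits_off c b S p.
Proof.
move=> compl; elim: p S => [x y|u p IH|s p IHp q IHq|x p IHp q IHq] S nS aS mS d sep;
  (* Each case may now choose the colour to split off, which is that of the principal formula
     whenever there is one. *)
  apply: splits_off_any => //.
- have [e _] := derives_axP d; have [sep1 _] := sep.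
  have [||b hb] := sep1 [fset [fset x; y]] [fset x; y];
    rewrite ?translation_ax ?fset11 //.
  by exists b; apply: splits_off_coloured; rewrite // e.
- have [T [e ok uT aT dp]] := derives_unP aS d.
  have := part_un e mS; rewrite /=; set b := c (un_principal u) => -[eb enb fb fnb].
  have mT : monochrome c T by apply: monochrome_sub mS; rewrite e fsubsetUr.
  have mT' : monochrome c (un_active u `|` T).
    by apply: monochrome_children (@children_un u) _; rewrite -e.
  rewrite translation_un in sep.
  have [||q [f [dq df mf ef]]] := IH _ _ aT mT' dp sep b.
  + by apply: leq_trans nS; rewrite e; apply: ltnW; apply: sequent_size_un.
  + by rewrite fb; apply/fset0Pn; have [a ha] := un_active_neq0 u; exists a;
      rewrite in_fsetU ha.
  exists b, (PUn u q), f; rewrite fb in dq; rewrite fnb in df; rewrite eb enb.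
  split=> //; first by apply: (@derives_unE _ _ _ (part c b T)); side.
  apply: (@equiv_trans _ _ _ _ _ (PUn u (mix_opt f q))).
    by apply: (@equiv_un _ _ _ T); side.
  by apply: (@equiv_mix_opt_un _ _ _ _ (part c b T) (part c (~~ b) T)); rewrite ?e; side.
- have [T [U [e ok sTU TU [aT aU dp dq]]]] := derives_splitP aS d.
  have [sepp sepq] := separated_split aS d sep.
  have [sT sU] := (apartUr _ _ _).1 sTU.
  have [nT nU] := sequent_size_split ok sTU TU (derives_neq0 dp) (derives_neq0 dq).
  rewrite -e in nT nU.
  have mST : monochrome c (split_principal s `|` T).
    by apply: monochrome_sub mS; rewrite e fsetUA fsubsetUl.
  have mSU : monochrome c (split_principal s `|` U).
    by apply: monochrome_sub mS; rewrite e fsetUCA fsubsetUr.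
  have mT : monochrome c T by apply: monochrome_sub mST; rewrite fsubsetUr.
  have mU : monochrome c U by apply: monochrome_sub mSU; rewrite fsubsetUr.
  have [b [cs ne]] := premise_colour mST (derives_neq0 dp).
  have ca := @coloured_premise c b false s T mST cs; have cb := @coloured_premise c b true s U mSU cs.
  have [fb fnb] := part_split T ca; have [gb gnb] := part_split U cb.
  have [|p1 [d1 [dp1 dd1 m1 e1]]] :=
    IHp _ _ aT (@monochrome_premise c false s T mST) dp sepp b ne.
    exact: leq_trans (ltnW nT) nS.
  rewrite fb in dp1; rewrite fnb in dd1.
  exists b; rewrite /splits_off e !partU (part_coloured cs) (part_coloured0 cs).
  rewrite fset0U.
  have [e0|ne'] := eqVneq (part c b (split_active true s `|` U)) fset0.
    (* A tensor would leave its right child, of colour [b], in this part. So the rule is a mix, and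
       all of [q] has the other colour and joins the residue. *)
    have es : s = RMix.
      case: (s) e0 gb => [x|] // e0 gb.
      have : child true x \in (fset0 : sequent) by rewrite -e0 gb /= !inE eqxx.
      by rewrite inE.
    subst s; rewrite /= !fset0U in e0 dp dq dp1 e1 *.
    have eU : U = part c (~~ b) U by rewrite {1}(partK c b U) e0 fset0U.
    exists p1, (mix_opts d1 (Some q)); rewrite e0 fsetU0 -eU.
    have mix_ok : mix by exact: ok.
    have DU : apart (part c (~~ b) T) U by part_tac.
    have PU : apart (part c b T) U by part_tac.
    split=> //.
    + by apply: (@derives_mix_opts _ _ _ (part c (~~ b) T) U).
    apply: (@equiv_trans _ _ _ _ _ (PSplit RMix (mix_opt d1 p1) q)).
      apply: (@equiv_split _ _ _ T U); rewrite /= ?fset0U //.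
      exact: equiv_refl.
    apply: (@equiv_trans _ _ _ _ _ (mix_opt d1 (PSplit RMix p1 q))).
      apply: (@equiv_split_mix_optl _ _ _ (part c b T) U (part c (~~ b) T)) => //;
        rewrite /= ?fset0U //; side.
    apply: (@equiv_trans _ _ _ _ _ (mix_opt d1 (mix_opt (Some q) p1))).
      apply: (@equiv_mix_opt _ _ _ (part c (~~ b) T) (part c b T `|` U)) => //; try side.
      exact: (@equiv_mixC _ _ _ (part c b T) U).
    by apply: (@equiv_mix_optA _ _ _ (part c (~~ b) T) U (part c b T)) => //; side.
  have [|q1 [d2 [dq1 dd2 m2 e2]]] :=
    IHq _ _ aU (@monochrome_premise c true s U mSU) dq sepq b ne'.
    exact: leq_trans (ltnW nU) nS.
  rewrite gb in dq1; rewrite gnb in dd2.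
  exists (PSplit s p1 q1), (mix_opts d1 d2); split.
  + by apply: (@derives_splitE _ _ _ (part c b T) (part c b U)); side.
  + by apply: (@derives_mix_opts _ _ _ (part c (~~ b) T) (part c (~~ b) U)) => //; side.
  + exact: mixable_opts.
  apply: (@equiv_trans _ _ _ _ _ (PSplit s (mix_opt d1 p1) (mix_opt d2 q1))).
    by apply: (@equiv_split _ _ _ T U).
  by apply: (@equiv_split_mix_opts _ _ _ (part c b T) (part c b U)
    (part c (~~ b) T) (part c (~~ b) U)) => //; side.
- have [T [e ok xT aT [dp dq]]] := derives_withP aS d.
  have := part_with false e mS; have := part_with true e mS.
  rewrite /=; set b := c x => -[_ _ gb gnb] [eb enb fb fnb].
  have mT : monochrome c T by apply: monochrome_sub mS; rewrite e fsubsetUr.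
  have mx : monochrome c [fset x] by apply: monochrome_sub mS; rewrite e fsubsetUl.
  have mT' b' : monochrome c ([fset child b' x] `|` T).
    by apply: monochrome_children (@children1 b' x) _; rewrite -e.
  have [sepp sepq] := separated_with aS mx d sep.
  have ne b' : part c b ([fset child b' x] `|` T) != fset0.
    apply/fset0Pn; exists (child b' x); rewrite in_part in_fsetU in_fset1 eqxx.
    by rewrite (mx x (child b' x)) ?below_child ?eqxx // inE.
  have nT b' : size ([fset child b' x] `|` T) < size S.
    by rewrite e; apply: sequent_size_with.
  have [|p1 [d1 [dp1 dd1 m1 e1]]] := IHp _ _ (aT _) (mT' _) dp sepp b (ne _).
    exact: leq_trans (ltnW (nT _)) nS.
  have [|q1 [d2 [dq1 dd2 m2 e2]]] := IHq _ _ (aT _) (mT' _) dq sepq b (ne _).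
    exact: leq_trans (ltnW (nT _)) nS.
  rewrite fb in dp1; rewrite fnb in dd1; rewrite gb in dq1; rewrite gnb in dd2.
  (* A & moves past a mix only if both its premises carry the same residue, so [d2] is exchanged for
     [d1]. *)
  have e3 : equiv ([fset child true x] `|` T) q (mix_opt d1 q1).
    have t2 := equiv_translation e2; apply: equiv_trans e2 _.
    apply: equiv_eq (_ : _ = part c (~~ b) T `|` ([fset child true x] `|` part c b T));
      last by side.
    have sub : part c (~~ b) T `<=` S.
      by apply: fsubset_trans (part_sub c _ T) _; rewrite e fsubsetUr.
    have mTb := monochrome_part mT.
    apply: (@mix_opt_residual n c _ S _ x p q _ _ p1 q1) => //.
    (* The residual sequent is part of [T], and [T] lacks [x]; this makes the inequality strict. *)
    + apply: leq_ltn_trans (sequent_size_sub G (part_sub c (~~ b) T)) _.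
      apply: leq_trans nS; rewrite e sequent_sizeU ?apart_disjoint //.
      by rewrite -addn1 addnC leq_add2r sequent_size_gt0 //; apply/fset0Pn; exists x; rewrite inE.
    + exact: antichain_sub aS sub.
    + exact: equiv_translation e1.
    + by exists (part c b ([fset child false x] `|` T));
        [rewrite fb | split; [exact: monochrome_part|exact: coloured_part]].
    + by exists (part c b ([fset child true x] `|` T));
        [rewrite gb | split; [exact: monochrome_part|exact: coloured_part]].
    + exact: coloured_part.
    + by part_tac.
  exists b, (PWith x p1 q1), d1; rewrite eb enb; split=> //.
    by apply: (@derives_withE _ _ _ (part c b T)); side.
  apply: (@equiv_trans _ _ _ _ _ (PWith x (mix_opt d1 p1) (mix_opt d1 q1))).
    by apply: (@equiv_with _ _ _ T).
  by apply: (@equiv_mix_opt_with _ _ _ _ (part c b T) (part c (~~ b) T)); rewrite ?e; side.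
Qed.

(** The two colours meet only in [x], and the left argument has colour [false], the right one
    [true]. Hence only the context [S] is assumed monochrome, and every other rule can be moved into
    the premise of its own colour. *)
Lemma tensor_separation n c x p S : complete_below n -> split_ok (RTensor x) ->
  (forall b v, below (child b x) v -> c v = b) ->
  size ([fset x] `|` S) <= n -> antichain ([fset x] `|` S) -> apart [fset x] S ->
  monochrome c S -> derives ([fset x] `|` S) p -> separated c (translation p) ->
  exists q r, [/\ derives (split_active false (RTensor x) `|` part c false S) q,
    derives (split_active true (RTensor x) `|` part c true S) r &
    equiv ([fset x] `|` S) p (PSplit (RTensor x) q r)].
Proof.
move=> compl okx hc; elim: p S => [y z|u p IH|t p IHp q IHq|y p IHp q IHq]
  S nS aS xS mS d sep.
- have [e [P [ey ez]]] := derives_axP d; move: okx => [A [B ex]].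
  have : x \in [fset y; z] by rewrite -e !inE eqxx.
  by rewrite !inE => /orP[]/eqP ex'; move: ex; rewrite ex' ?ey ?ez.
- have [T [e oku uT aT dp]] := derives_unP aS d.
  have ne : un_principal u != x.
    apply/eqP => ev; move: okx oku => [A [B ex]]; rewrite -ev in ex.
    by case: (u) ex => [y|b y] /= ex [C [D]]; rewrite ex.
  have nT : size (un_active u `|` T) <= n.
    by apply: leq_trans nS; rewrite e; apply: ltnW; apply: sequent_size_un.
  have [R [eS eT uR ux xR]] := locate_un xS uT e ne.
  have eR : un_active u `|` T = [fset x] `|` (un_active u `|` R).
    by rewrite eT fsetUCA.
  rewrite eR in aT dp nT; rewrite translation_un in sep.
  have mR' : monochrome c (un_active u `|` R).
    by apply: monochrome_children (@children_un u) _; rewrite -eS.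
  have mR : monochrome c R by apply: monochrome_sub mR'; rewrite fsubsetUr.
  have [|q [r [dq dr ep]]] := IH (un_active u `|` R) nT aT _ mR' dp sep.
    by part_tac.
  have ep' : equiv ([fset x] `|` S) (PUn u p) (PUn u (PSplit (RTensor x) q r)).
    rewrite eS; apply: (@equiv_un _ _ _ ([fset x] `|` R)); try side.
    by apply: equiv_eq ep _; fset_ac.
  (* The colour of the principal formula of [u] decides into which premise of the tensor [u]
     moves. *)
  have := part_un eS mS; case: (c (un_principal u)) => /= -[eb enb fb fnb].
    rewrite fb in dr; rewrite fnb in dq.
    exists q, (PUn u r); rewrite eb enb; split=> //.
      by apply: (@derives_unE _ _ _ (split_active true (RTensor x) `|` part c true R)); side.
    apply: equiv_trans ep' _; apply: equiv_sym.
    by rewrite eS; apply: (@equiv_split_unr _ _ _ _ (part c false R) (part c true R)); side.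
  rewrite fb in dq; rewrite fnb in dr.
  exists (PUn u q), r; rewrite eb enb; split=> //.
    by apply: (@derives_unE _ _ _ (split_active false (RTensor x) `|` part c false R)); side.
  apply: equiv_trans ep' _; apply: equiv_sym.
  by rewrite eS; apply: (@equiv_split_unl _ _ _ _ (part c false R) (part c true R)); side.
- have [T [U [e okt sTU TU [aT aU dp dq]]]] := derives_splitP aS d.
  have [sepp sepq] := separated_split aS d sep.
  have [sT sU] := (apartUr _ _ _).1 sTU.
  have [nT nU] := sequent_size_split okt sTU TU (derives_neq0 dp) (derives_neq0 dq).
  rewrite -e in nT nU.
  have [xt|xt] := boolP (x \in split_principal t).
    have et : t = RTensor x.
      by case: (t) xt => [y|] //=; rewrite inE => /eqP->.
    subst t; have eS : S = T `|` U.
      apply: (@fset1U_inj x); [exact: apart_notin1|exact: apart_notin1|exact: e].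
    have mT : monochrome c T by apply: monochrome_sub mS; rewrite eS fsubsetUl.
    have mU : monochrome c U by apply: monochrome_sub mS; rewrite eS fsubsetUr.
    have mc b : monochrome c (split_active b (RTensor x)).
      by move=> u v; rewrite inE => /eqP-> /hc->; rewrite (hc b) ?below_refl.
    have cc b : coloured c b (split_active b (RTensor x)).
      by move=> u; rewrite inE => /eqP->; apply: hc; rewrite below_refl.
    have [fb fnb] := part_split T (cc false); have [gb gnb] := part_split U (cc true).
    (* The tensor is already at the bottom, but its premises may contain pieces of the wrong colour.
       These are split off as [d1] and [d2], and then each is mixed into the opposite premise. *)
    have [||p1 [d1 [dp1 dd1 m1 e1]]] :=
        mix_separation compl _ aT (monochromeU (mc _) mT) dp sepp (b := false).
    + exact: leq_trans (ltnW nT) nS.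
    + by rewrite fb; apply/fset0Pn; exists (child false x); rewrite !inE eqxx.
    have [||q1 [d2 [dq1 dd2 m2 e2]]] :=
        mix_separation compl _ aU (monochromeU (mc _) mU) dq sepq (b := true).
    + exact: leq_trans (ltnW nU) nS.
    + by rewrite gb; apply/fset0Pn; exists (child true x); rewrite !inE eqxx.
    rewrite fb in dp1; rewrite fnb /= in dd1; rewrite gb in dq1; rewrite gnb /= in dd2.
    exists (mix_opt d2 p1), (mix_opt d1 q1); rewrite eS !partU; split.
    + by apply: (@derives_mix_opt _ _ _ (part c false U)
        (split_active false (RTensor x) `|` part c false T)) => //; side.
    + by apply: (@derives_mix_opt _ _ _ (part c true T)
        (split_active true (RTensor x) `|` part c true U)) => //; side.
    apply: (@equiv_trans _ _ _ _ _ (PSplit (RTensor x) (mix_opt d1 p1) (mix_opt d2 q1))).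
      by apply: (@equiv_split _ _ _ T U).
    apply: (@equiv_trans _ _ _ _ _
        (mix_opt d1 (PSplit (RTensor x) p1 (mix_opt d2 q1)))).
      apply: (@equiv_split_mix_optl _ _ _ (part c false T)
        (part c false U `|` part c true U) (part c true T)) => //; try side.
      by apply: (@derives_mix_opt _ _ _ (part c false U)
        (split_active true (RTensor x) `|` part c true U)) => //; side.
    apply: (@equiv_trans _ _ _ _ _
        (mix_opt d1 (PSplit (RTensor x) (mix_opt d2 p1) q1))).
      apply: (@equiv_mix_opt _ _ _ (part c true T) (split_principal (RTensor x) `|`
        (part c false T `|` part c false U `|` part c true U))) => //; try side.
      apply: (@equiv_trans _ _ _ _ _ (mix_opt d2 (PSplit (RTensor x) p1 q1))).
        by apply: (@equiv_split_mix_optr _ _ _ (part c false T) (part c true U)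
          (part c false U)) => //; side.
      by apply: equiv_sym; apply: (@equiv_split_mix_optl _ _ _ (part c false T)
        (part c true U) (part c false U)) => //; side.
    apply: equiv_sym; apply: (@equiv_split_mix_optr _ _ _
      (part c false T `|` part c false U) (part c true U) (part c true T)) => //; try side.
    by apply: (@derives_mix_opt _ _ _ (part c false U)
      (split_active false (RTensor x) `|` part c false T)) => //; side.
  have [] := locate_split xS sTU TU e xt.
    move=> [R [eT eS [xR xU xt' RU [tR tU]]]].
    have eR : split_active false t `|` T = [fset x] `|` (split_active false t `|` R).
      by rewrite eT fsetUCA.
    rewrite eR in aT dp nT.
    have mtR : monochrome c (split_principal t `|` R).
      by apply: monochrome_sub mS; rewrite eS fsetUA fsubsetUl.
    have mtU : monochrome c (split_principal t `|` U).
      by apply: monochrome_sub mS; rewrite eS fsetUCA fsubsetUr.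
    have mR : monochrome c R by apply: monochrome_sub mtR; rewrite fsubsetUr.
    have mU : monochrome c U by apply: monochrome_sub mtU; rewrite fsubsetUr.
    have [||p1 [p2 [dp1 dp2 ep]]] := IHp (split_active false t `|` R) _ aT _
      (@monochrome_premise c false t R mtR) dp sepp.
    + exact: leq_trans (ltnW nT) nS.
    + by part_tac.
    (* [q] does not contain [x] and is handled by [mix_separation]. Its part of the colour [b] of
       [t] stays with [t], while the residue [d1] is mixed into the premise of the tensor that has
       the other colour. *)
    have [b [cs ne]] := premise_colour mtU (derives_neq0 dq).
    have ca := @coloured_premise c b false t R mtR cs.
    have cb := @coloured_premise c b true t U mtU cs.
    have [fb fnb] := part_split R ca; have [gb gnb] := part_split U cb.
    have [|q1 [d1 [dq1 dd1 m1 eq]]] := mix_separation compl _ aU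
        (@monochrome_premise c true t U mtU) dq sepq ne.
      exact: leq_trans (ltnW nU) nS.
    rewrite gb in dq1; rewrite gnb in dd1.
    have ep' : equiv ([fset x] `|` S) (PSplit t p q)
        (mix_opt d1 (PSplit t (PSplit (RTensor x) p1 p2) q1)).
      apply: (@equiv_trans _ _ _ _ _ (PSplit t (PSplit (RTensor x) p1 p2) (mix_opt d1 q1))).
        apply: (@equiv_split _ _ _ ([fset x] `|` R) U); try side.
          by rewrite eS; side.
        by apply: equiv_eq ep _; fset_ac.
      rewrite eS; apply: (@equiv_split_mix_optr _ _ _ ([fset x] `|` R) (part c b U)
        (part c (~~ b) U)) => //; try side.
      by case: ep => _ h _; apply: derives_eq h _; fset_ac.
    case: b cs ca cb ne fb fnb gb gnb dq1 dd1 eq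
      => /= cs ca cb ne fb fnb gb gnb dq1 dd1 eq.
      rewrite fb in dp2; rewrite fnb in dp1.
      exists (mix_opt d1 p1), (PSplit t p2 q1).
      rewrite eS !partU (part_coloured cs) (part_coloured0 cs) fset0U; split.
      + by apply: (@derives_mix_opt _ _ _ (part c false U)
          (split_active false (RTensor x) `|` part c false R)) => //; side.
      + by apply: (@derives_splitE _ _ _ (split_active true (RTensor x) `|` part c true R)
          (part c true U)); side.
      rewrite eS in ep'; apply: equiv_trans ep' _.
      apply: (@equiv_trans _ _ _ _ _
          (mix_opt d1 (PSplit (RTensor x) p1 (PSplit t p2 q1)))).
        apply: (@equiv_mix_opt _ _ _ (part c false U) ([fset x] `|`
          (split_principal t `|` (R `|` part c true U)))) => //; try side.
        by apply: equiv_sym; apply: (@equiv_split_split_RL _ _ _ (part c false R)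
          (part c true R) (part c true U)); side.
      apply: equiv_sym; apply: (@equiv_split_mix_optl _ _ _ (part c false R)
        (split_principal t `|` (part c true R `|` part c true U))
        (part c false U)) => //; try side.
      by apply: (@derives_splitE _ _ _ (split_active true (RTensor x) `|` part c true R)
          (part c true U)); side.
    rewrite fb in dp1; rewrite fnb in dp2.
    exists (PSplit t p1 q1), (mix_opt d1 p2).
    rewrite eS !partU (part_coloured cs) (part_coloured0 cs) fset0U; split.
    + by apply: (@derives_splitE _ _ _ (split_active false (RTensor x) `|` part c false R)
        (part c false U)); side.
    + by apply: (@derives_mix_opt _ _ _ (part c true U)
        (split_active true (RTensor x) `|` part c true R)) => //; side.
    rewrite eS in ep'; apply: equiv_trans ep' _.
    apply: (@equiv_trans _ _ _ _ _
        (mix_opt d1 (PSplit (RTensor x) (PSplit t p1 q1) p2))).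
      apply: (@equiv_mix_opt _ _ _ (part c true U) ([fset x] `|`
        (split_principal t `|` (R `|` part c false U)))) => //; try side.
      by apply: (@equiv_split_split_LL _ _ _ (part c false R)
        (part c true R) (part c false U)); side.
    apply: equiv_sym; apply: (@equiv_split_mix_optr _ _ _
      (split_principal t `|` (part c false R `|` part c false U))
      (part c true R) (part c true U)) => //; try side.
    by apply: (@derives_splitE _ _ _ (split_active false (RTensor x) `|` part c false R)
        (part c false U)); side.
  move=> [R [eU eS [xR xT xt' TR [tT tR]]]].
  have eR : split_active true t `|` U = [fset x] `|` (split_active true t `|` R).
    by rewrite eU fsetUCA.
  rewrite eR in aU dq nU.
  have mtT : monochrome c (split_principal t `|` T).
    by apply: monochrome_sub mS; rewrite eS fsetUA fsubsetUl.
  have mtR : monochrome c (split_principal t `|` R).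
    by apply: monochrome_sub mS; rewrite eS fsetUCA fsubsetUr.
  have mT : monochrome c T by apply: monochrome_sub mtT; rewrite fsubsetUr.
  have mR : monochrome c R by apply: monochrome_sub mtR; rewrite fsubsetUr.
  have [||q1 [q2 [dq1 dq2 eq]]] := IHq (split_active true t `|` R) _ aU _
    (@monochrome_premise c true t R mtR) dq sepq.
  + exact: leq_trans (ltnW nU) nS.
  + by part_tac.
  (* The same with the premises of [t] exchanged: now [p] is the one without [x]. *)
  have [b [cs ne]] := premise_colour mtT (derives_neq0 dp).
  have ca := @coloured_premise c b false t T mtT cs.
  have cb := @coloured_premise c b true t R mtR cs.
  have [fb fnb] := part_split T ca; have [gb gnb] := part_split R cb.
  have [|p1 [d1 [dp1 dd1 m1 ep]]] := mix_separation compl _ aT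
      (@monochrome_premise c false t T mtT) dp sepp ne.
    exact: leq_trans (ltnW nT) nS.
  rewrite fb in dp1; rewrite fnb in dd1.
  have ep' : equiv ([fset x] `|` S) (PSplit t p q)
      (mix_opt d1 (PSplit t p1 (PSplit (RTensor x) q1 q2))).
    apply: (@equiv_trans _ _ _ _ _ (PSplit t (mix_opt d1 p1) (PSplit (RTensor x) q1 q2))).
      apply: (@equiv_split _ _ _ T ([fset x] `|` R)); try side.
        by rewrite eS; side.
      by apply: equiv_eq eq _; fset_ac.
    rewrite eS; apply: (@equiv_split_mix_optl _ _ _ (part c b T) ([fset x] `|` R)
      (part c (~~ b) T)) => //; try side.
    by case: eq => _ h _; apply: derives_eq h _; fset_ac.
  case: b cs ca cb ne fb fnb gb gnb dp1 dd1 ep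
    => /= cs ca cb ne fb fnb gb gnb dp1 dd1 ep.
    rewrite gb in dq2; rewrite gnb in dq1.
    exists (mix_opt d1 q1), (PSplit t p1 q2).
    rewrite eS !partU (part_coloured cs) (part_coloured0 cs) fset0U; split.
    + by apply: (@derives_mix_opt _ _ _ (part c false T)
        (split_active false (RTensor x) `|` part c false R)) => //; side.
    + by apply: (@derives_splitE _ _ _ (part c true T)
        (split_active true (RTensor x) `|` part c true R)); side.
    rewrite eS in ep'; apply: equiv_trans ep' _.
    apply: (@equiv_trans _ _ _ _ _
        (mix_opt d1 (PSplit (RTensor x) q1 (PSplit t p1 q2)))).
      apply: (@equiv_mix_opt _ _ _ (part c false T) ([fset x] `|`
        (split_principal t `|` (R `|` part c true T)))) => //; try side.
      by apply: (@equiv_split_split_RR _ _ _ (part c true T)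
        (part c false R) (part c true R)); side.
    apply: equiv_sym; apply: (@equiv_split_mix_optl _ _ _ (part c false R)
      (split_principal t `|` (part c true T `|` part c true R))
      (part c false T)) => //; try side.
    by apply: (@derives_splitE _ _ _ (part c true T)
      (split_active true (RTensor x) `|` part c true R)); side.
  rewrite gb in dq1; rewrite gnb in dq2.
  exists (PSplit t p1 q1), (mix_opt d1 q2).
  rewrite eS !partU (part_coloured cs) (part_coloured0 cs) fset0U; split.
  + by apply: (@derives_splitE _ _ _ (part c false T)
      (split_active false (RTensor x) `|` part c false R)); side.
  + by apply: (@derives_mix_opt _ _ _ (part c true T)
      (split_active true (RTensor x) `|` part c true R)) => //; side.
  rewrite eS in ep'; apply: equiv_trans ep' _.
  apply: (@equiv_trans _ _ _ _ _
      (mix_opt d1 (PSplit (RTensor x) (PSplit t p1 q1) q2))).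
    apply: (@equiv_mix_opt _ _ _ (part c true T) ([fset x] `|`
      (split_principal t `|` (R `|` part c false T)))) => //; try side.
    by apply: (@equiv_split_split_RL _ _ _ (part c false T)
      (part c false R) (part c true R)); side.
  apply: equiv_sym; apply: (@equiv_split_mix_optr _ _ _
    (split_principal t `|` (part c false T `|` part c false R))
    (part c true R) (part c true T)) => //; try side.
  by apply: (@derives_splitE _ _ _ (part c false T)
    (split_active false (RTensor x) `|` part c false R)); side.
- have [T [e oky yT aT [dp dq]]] := derives_withP aS d.
  have ne : y != x.
    by apply/eqP => eyx; move: okx oky => [A [B ex]] [C [D]]; rewrite eyx ex.
  have nT b : size ([fset child b y] `|` T) < size ([fset x] `|` S).
    by rewrite e; apply: sequent_size_with.
  have [R [eS eT yR yx xR]] := locate_with xS yT e ne.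
  have eR b : [fset child b y] `|` T = [fset x] `|` ([fset child b y] `|` R).
    by rewrite eT fsetUCA.
  have my : monochrome c [fset y] by apply: monochrome_sub mS; rewrite eS fsubsetUl.
  have [sepp sepq] := separated_with aS my d sep.
  have mR' b : monochrome c ([fset child b y] `|` R).
    by apply: monochrome_children (@children1 b y) _; rewrite -eS.
  have mR : monochrome c R by apply: monochrome_sub (mR' true); rewrite fsubsetUr.
  have aR b : antichain ([fset x] `|` ([fset child b y] `|` R)) by rewrite -eR.
  have nR b : size ([fset x] `|` ([fset child b y] `|` R)) <= n.
    by rewrite -eR; apply: leq_trans (ltnW (nT b)) nS.
  rewrite eR in dp; rewrite eR in dq.
  have [|p1 [p2 [dp1 dp2 ep]]] := IHp _ (nR _) (aR _) _ (mR' _) dp sepp.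
    by part_tac.
  have [|q1 [q2 [dq1 dq2 eq]]] := IHq _ (nR _) (aR _) _ (mR' _) dq sepq.
    by part_tac.
  have ep' : equiv ([fset x] `|` S) (PWith y p q)
      (PWith y (PSplit (RTensor x) p1 p2) (PSplit (RTensor x) q1 q2)).
    rewrite eS; apply: (@equiv_with _ _ _ ([fset x] `|` R)); try side.
      by apply: equiv_eq ep _; fset_ac.
    by apply: equiv_eq eq _; fset_ac.
  have ma b b' X : monochrome c X -> monochrome c (split_active b (RTensor x) `|` part c b' X).
    move=> mX; apply: monochromeU; last exact: monochrome_part.
    by move=> u v; rewrite inE => /eqP-> /hc->; rewrite (hc b) ?below_refl.
  have cc b X : coloured c b (split_active b (RTensor x) `|` part c b X).
    apply: colouredU; last exact: coloured_part.
    by move=> u; rewrite inE => /eqP->; apply: hc; rewrite below_refl.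
  have ax b : antichain (split_active b (RTensor x) `|` part c b R).
    apply: antichainU; [exact: antichain_children (@children1 b x)| |by part_tac].
    apply: antichain_sub (aR b) _; apply: fsubset_trans (part_sub c b R) _.
    by rewrite fsetUA fsubsetUr.
  have sx b : size (split_active b (RTensor x) `|` part c b R) < n.
    apply: leq_trans nS; rewrite eS.
    apply: (@leq_ltn_trans (size (split_active b (RTensor x) `|` R))).
      by apply: sequent_size_sub; apply: fsetUSS; rewrite ?part_sub.
    apply: leq_trans (_ : size ([fset x] `|` R) <= _); last first.
      by apply: sequent_size_sub; apply: fsetUSS; rewrite ?fsubsetUr.
    have ac b' (X : sequent) : split_active b' (RTensor x) `|` X != fset0.
      by apply/fset0Pn; exists (child b' x); rewrite !inE eqxx.
    (* Each side is measured as a premise of a tensor at [x] whose other context is empty. *)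
    have [||h1 _] := @sequent_size_split _ mix G (RTensor x) R fset0 okx _ _ (ac _ _) (ac _ _).
    - by part_tac.
    - by part_tac.
    have [||_ h2] := @sequent_size_split _ mix G (RTensor x) fset0 R okx _ _ (ac _ _) (ac _ _).
    - by part_tac.
    - by part_tac.
    by case: b; rewrite ?fsetU0 ?fset0U in h1 h2.
  have tp := equiv_translation ep; have tq := equiv_translation eq.
  have W b b' := ma b b _ (mR' b').
  have := part_with true eS mS; have := part_with false eS mS.
  case E: (c y) => /= -[eb enb fb fnb] [_ _ gb gnb].
    (* [y] has the colour of the right side, so the & moves there. The left premises [p1] and [q1]
       then prove the same sequent and must be identified before the two copies of the tensor can be
       merged. *)
    have e1 : equiv (split_active false (RTensor x) `|` part c false R) p1 q1.
      rewrite fnb in dp1; rewrite gnb in dq1.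
      rewrite [RHS]translation_splitC in tp; rewrite [RHS]translation_splitC in tq.
      apply: with_residual compl (sx _) (ax _) aS my d sep tp tq _ _ _ _ dp1 dq1;
        rewrite ?E.
      + exists (split_active true (RTensor x) `|` part c true ([fset child false y] `|` R)) => //.
      + exists (split_active true (RTensor x) `|` part c true ([fset child true y] `|` R)) => //.
      + exact: (ma false false R mR).
      + exact: (cc false R).
    rewrite fnb in dp1; rewrite fb in dp2; rewrite gb in dq2.
    exists p1, (PWith y p2 q2); rewrite eb enb; split=> //.
      by apply: (@derives_withE _ _ _ (split_active true (RTensor x) `|` part c true R)); side.
    apply: equiv_trans ep' _.
    apply: (@equiv_trans _ _ _ _ _ (PWith y (PSplit (RTensor x) p1 p2)
        (PSplit (RTensor x) p1 q2))).
      rewrite eS; apply: (@equiv_with _ _ _ ([fset x] `|` R)); try side.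
        by apply: equiv_refl; case: ep => _ h _; apply: derives_eq h _; fset_ac.
      apply: (@equiv_split _ _ _ (part c false R) ([fset child true y] `|` part c true R));
        try side.
        exact: equiv_sym.
      exact: equiv_refl.
    apply: equiv_sym; rewrite eS.
    by apply: (@equiv_split_withr _ _ _ _ (part c false R) (part c true R)); side.
  have e1 : equiv (split_active true (RTensor x) `|` part c true R) p2 q2.
    rewrite fnb in dp2; rewrite gnb in dq2.
    apply: with_residual compl (sx _) (ax _) aS my d sep tp tq _ _ _ _ dp2 dq2;
      rewrite ?E.
      + exists (split_active false (RTensor x) `|` part c false ([fset child false y] `|` R)) => //.
      + exists (split_active false (RTensor x) `|` part c false ([fset child true y] `|` R)) => //.
      + exact: (ma true true R mR).
      + exact: (cc true R).
  rewrite fnb in dp2; rewrite fb in dp1; rewrite gb in dq1.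
  exists (PWith y p1 q1), p2; rewrite eb enb; split=> //.
    by apply: (@derives_withE _ _ _ (split_active false (RTensor x) `|` part c false R)); side.
  apply: equiv_trans ep' _.
  apply: (@equiv_trans _ _ _ _ _ (PWith y (PSplit (RTensor x) p1 p2)
      (PSplit (RTensor x) q1 p2))).
    rewrite eS; apply: (@equiv_with _ _ _ ([fset x] `|` R)); try side.
      by apply: equiv_refl; case: ep => _ h _; apply: derives_eq h _; fset_ac.
    apply: (@equiv_split _ _ _ ([fset child true y] `|` part c false R) (part c true R));
      try side.
      exact: equiv_refl.
    exact: equiv_sym.
  apply: equiv_sym; rewrite eS.
  by apply: (@equiv_split_withl _ _ _ _ (part c false R) (part c true R)); side.
Qed.

End Separations.

(** * From equal linkings to conversion *)

Section Completeness.

Variables (V : Type) (mix : bool) (G : seq (form V)).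

Notation derives := (derives mix G).
Notation equiv := (equiv mix G).
Notation conv := (convertible mix G).

(** [S] consists of two literals, which excludes every logical rule; the remaining case to refute is
    a mix. *)
Lemma ax_unique S x y p : antichain S -> derives S (PAx x y) -> derives S p ->
  translation p = translation (PAx x y) -> p = PAx x y.
Proof.
move=> aS dq d tr; have [eS [P [ex ey]]] := derives_axP dq.
have lit z : z \in S -> subform G z = Some (Var P) \/ subform G z = Some (NVar P).
  by rewrite eS !inE => /orP[]/eqP->; [left|right].
case: p d tr => [x' y'|u p|s p q|z p q] d tr.
- have [e [Q [ex' ey']]] := derives_axP d.
  have hx : x' = x.
    have : x' \in [fset x; y] by rewrite -eS e !inE eqxx.
    by rewrite !inE => /orP[]/eqP ez //; move: ex'; rewrite ez ey.
  have hy : y' = y.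
    have : y' \in [fset x; y] by rewrite -eS e !inE eqxx orbT.
    by rewrite !inE => /orP[]/eqP ez //; move: ey'; rewrite ez ex.
  by rewrite hx hy.
- have [T [e ok _ _ _]] := derives_unP aS d.
  have /lit : un_principal u \in S by rewrite e !inE eqxx.
  by case: (u) ok => [z|b z] /= [A [B ->]] [].
- have [T [U [e ok _ TU [_ _ dp dq']]]] := derives_splitP aS d.
  case: s e ok d tr dp dq' => [z|] /= e ok d tr dp dq'.
    have /lit : z \in S by rewrite e !inE eqxx.
    by case: ok => [A [B ->]] [].
  rewrite !fset0U in e dp dq'.
  have [l hl] := translation_neq0 p; have [m hm] := translation_neq0 q.
  have : l `|` m \in translation (PAx x y).
    by rewrite -tr; apply: in_translation_split.
  rewrite translation_ax in_fset1 => /eqP elm.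
  have xS : x \in T `|` U by rewrite -e eS !inE eqxx.
  (* A premise of a mix has some link, which can only be the unique one of the axiom. Its sequent
     therefore contains [x], which cannot hold for both premises. *)
  have H R r k : R `<=` S -> derives R r -> k \in translation r ->
      k `<=` l `|` m -> x \in R.
    move=> /fsubsetP RS dr hk /fsubsetP klm; have /fset0Pn[t tR] := derives_neq0 dr.
    have /touchesP[h [_ [hk' _ _]]] := derives_touches dr hk tR.
    have : x \in h by move: (klm _ hk'); rewrite elm in_fset1 => /eqP->; rewrite !inE eqxx.
    have [_ cov] := derives_covers dr hk hk'.
    move=> /cov/underP[u uR ux]; have <- // : u = x.
    by apply: aS (RS _ uR) _ ux; rewrite e.
  have xT : x \in T by apply: (H T p l); rewrite ?e ?fsubsetUl.
  have xU : x \in U by apply: (H U q m); rewrite ?e ?fsubsetUr.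
  by have := TU x x xT xU; rewrite cmp_refl.
- have [T [e ok _ _ _]] := derives_withP aS d.
  have /lit : z \in S by rewrite e !inE eqxx.
  by case: ok => [A [B ->]] [].
Qed.

Lemma translation_complete n : complete_below mix G n.
Proof.
elim: n => // n IH S p q nS aS dp dq tr; rewrite ltnS in nS.
have IH' T p' q' : sequent_size G T < sequent_size G S -> antichain T ->
    derives T p' -> derives T q' -> translation p' = translation q' -> conv p' q'.
  by move=> h; apply: IH; apply: leq_trans nS.
case: q dq tr => [x y|u q|s q1 q2|x q1 q2] dq tr.
- by rewrite (ax_unique aS dq dp tr); apply: rst_refl.
- have [T [e ok uT aT dq']] := derives_unP aS dq; rewrite translation_un in tr.
  (* The linkings are those of the premise of [u], whose sequent contains the chosen child and is
     incomparable with the other one. *)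
  have ag : agrees u (translation p).
    rewrite tr; case: u ok uT aT dq' {e dq} => //= b x _ uT aT dq' l hl.
    apply: not_touches (derives_covers dq' hl); apply/apartUr.
    split; last exact: apart_child.
    move=> v w; rewrite !in_fset1 => /eqP-> /eqP->.
    by apply/negP => /cmp_children; case: b {uT aT dq' hl}.
  rewrite e in aS dp nS; have [p' dp' ep] := un_at_bottom ok ag aS uT dp.
  have tp := equiv_translation ep; rewrite translation_un in tp.
  case: ep => _ _ cp; apply: rst_trans cp _.
  apply: conv_lift => [r r'|]; first exact: CUn.
  apply: (IH' (un_active u `|` T)) => //; last by rewrite -tp.
  by rewrite e; apply: sequent_size_un.
- have [T [U [e ok sTU TU [aT aU dq1 dq2]]]] := derives_splitP aS dq.
  pose A := split_active false s `|` T; pose B := split_active true s `|` U.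
  have [sT sU] := (apartUr _ _ _).1 sTU.
  have AB : apart A B.
    apply/apartUl; split; apply/apartUr; split=> //.
    + exact: apart_split_active.
    + exact: apart_split.
    + by apply/apartC; apply: apart_split.
  (* Vertices under neither premise get [false] by default; only the colours under [A] and [B] are
     used. For a tensor the two arguments thus differ in colour, and [mTU] speaks of the context
     alone. *)
  pose c := under B.
  have cA v : under A v -> c v = false.
    move=> /underP[u uA uv]; apply/negP => /underP[w wB wv].
    by have := AB _ _ uA wB; rewrite (below_cmp uv wv).
  have cB v : under B v -> c v = ~~ false by [].
  have sep : separated c (translation p).
    by rewrite tr; apply: (split_separated s dq1 dq2 cA cB).
  have TA v : under T v -> c v = false.
    by move=> h; apply: cA; apply: under_sub h; rewrite fsubsetUr.
  have UB v : under U v -> c v = true.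
    by move=> h; apply: cB; apply: under_sub h; rewrite fsubsetUr.
  have cT : coloured c false T by move=> v /underS /TA.
  have cU : coloured c true U by move=> v /underS /UB.
  have mTU : monochrome c (T `|` U).
    apply: monochromeU => u v uS uv.
      by rewrite (cT u uS); apply: TA; apply/underP; exists u.
    by rewrite (cU u uS); apply: UB; apply/underP; exists u.
  have [nA nB] := sequent_size_split ok sTU TU (derives_neq0 dq1) (derives_neq0 dq2).
  rewrite -e in nA nB.
  have [p1 [p2 [dp1 dp2 ep]]] : exists p1 p2,
      [/\ derives A p1, derives B p2 & conv p (PSplit s p1 p2)].
    case: s @A @B @c e ok dq sTU sT sU aT aU dq1 dq2 tr cA cB sep TA UB cT cU mTU nA nB AB
      => [x|] A B c e ok dq sTU sT sU aT aU dq1 dq2 tr cA cB sep TA UB cT cU mTU nA nB AB.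
      rewrite e in aS dp nS.
      have hc b v : below (child b x) v -> c v = b.
        by case: b => h; [apply: cB|apply: cA]; apply/underP;
          [exists (child true x)|exists (child false x)]; rewrite // !inE eqxx.
      have [p1 [p2 [dp1 dp2 [_ _ cp]]]] :=
        tensor_separation IH ok hc nS aS sTU mTU dp sep.
      exists p1, p2; rewrite !partU in dp1 dp2.
      rewrite (part_coloured cT) (part_coloured0 cU) fsetU0 in dp1.
      by rewrite (part_coloured0 cT) (part_coloured cU) fset0U in dp2.
    rewrite /= fset0U in e; rewrite e in aS dp nS.
    have pT : part c false (T `|` U) = T.
      by rewrite partU (part_coloured cT) (part_coloured0 cU) fsetU0.
    have pU : part c true (T `|` U) = U.
      by rewrite partU (part_coloured0 cT) (part_coloured cU) fset0U.
    have [|p1 [[p2|] [dp1 dp2 md [_ _ cp]]]] :=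
      mix_separation IH nS aS mTU dp sep (b := false).
    + by rewrite pT; have := derives_neq0 dq1; rewrite fset0U.
    (* The residue [p2] stands first in [mix_opt], so the premises of the mix are turned round. *)
    + exists p1, p2; rewrite /A /B !fset0U; rewrite pT in dp1.
      rewrite /= pU in dp2; split=> //; apply: rst_trans cp _.
      by apply: rst_step; apply: CMixC.
    + by have := derives_neq0 dq2; rewrite fset0U -pU (dp2 : _ = fset0) eqxx.
  have tp := convertible_translation ep; apply: rst_trans ep _.
  (* Both splits have their premises on [A] and [B]; selecting a colour in the common translation
     gives equal translations of corresponding premises. *)
  have [e1 e2] := separated_links s dp1 dp2 cA cB.
  have [e3 e4] := separated_links s dq1 dq2 cA cB.
  apply: (@rst_trans _ _ _ (PSplit s q1 p2)).
    apply: (conv_lift (f := fun r => PSplit s r p2)) => [r r'|]; first exact: CSplitL.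
    by apply: (IH' A) => //; rewrite e1 e3 -tp tr.
  apply: (conv_lift (f := PSplit s q1)) => [r r'|]; first exact: CSplitR.
  by apply: (IH' B) => //; rewrite e2 e4 -tp tr.
- have [T [e ok xT aT [dq1 dq2]]] := derives_withP aS dq.
  have aS' := aS; have dp' := dp; rewrite e in aS' dp'.
  have [p1 [p2 [dp1 dp2 ep]]] := with_at_bottom ok aS' xT dp'.
  have tp := equiv_translation ep; case: ep => _ dw cp.
  apply: rst_trans cp _; rewrite -e in dw.
  apply: (@rst_trans _ _ _ (PWith x q1 p2)).
    apply: (conv_lift (f := fun r => PWith x r p2)) => [r r'|]; first exact: CWithL.
    apply: (IH' ([fset child false x] `|` T)) => //.
      by rewrite e; apply: sequent_size_with.
    by rewrite (with_translationl aS dw) (with_translationl aS dq) -tp tr.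
  apply: (conv_lift (f := PWith x q1)) => [r r'|]; first exact: CWithR.
  apply: (IH' ([fset child true x] `|` T)) => //.
    by rewrite e; apply: sequent_size_with.
  by rewrite (with_translationr aS dw) (with_translationr aS dq) -tp tr.
Qed.

End Completeness.

Lemma antichain_root V (G : seq (form V)) : antichain (root_sequent G).
Proof.
move=> u v; rewrite !in_fset => /mapP[i _ ->] /mapP[j _ ->].
by rewrite /below => /andP[/= /eqP-> _].
Qed.

Theorem theorem1 (V : Type) (mix : bool) (G : seq (form V)) (p q : proof)
    (hp : is_proof mix G p) (hq : is_proof mix G q) :
  translation p = translation q <-> convertible mix G p q.
Proof.
split; last exact: convertible_translation.
exact: (translation_complete (ltnSn _) (@antichain_root _ G) hp hq).
Qed.
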